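(* Let $\chi$ be a character of $H$ whose restriction to $H_{2(h-1)}$, viewed as a character of $\mathbb{F}_{q^2}$ via $a\mapsto1+a\tau^{2(h-1)}$, has conductor $q^2$, and let $\rho_\chi$ be the irreducible representation of $\mathcal U$ defined below. Then, in the Grothendieck group of representations of $H$, $$\rho_\chi|_H=(-1)^h\Big(q\cdot\chi+\sum_{i=1}^{h-2}(-1)^i(q+1)\,\mathrm{Ind}_{G_i}^H(\chi|_{G_i})\Big).$$
   Context: Let $p$ be a prime, $q$ a power of $p$, $\ell\ne p$, and $h\ge2$ an integer. For a commutative $\mathbb{F}_q$-algebra $A$, $U_h^{2,q}(A)$ is the set of formal expressions $1+\sum_{i=1}^{2(h-1)}a_i\tau^i$ with multiplication obtained by extending $(a\tau^i)(b\tau^j)=ab^{q^i}\tau^{i+j}$ bi-additively, $\tau^0=1$, $\tau^k=0$ for $k>2(h-1)$. Put $\mathcal U=U_h^{2,q}(\mathbb{F}_{q^2})$. Subgroups: $H=\{a_i=0\text{ for odd }i\}$ (abelian); $H_{2(h-1)}=\{1+a\tau^{2(h-1)}\}$; $G_k=\{1+\sum a_{2i}\tau^{2i}\in H: a_{2i}\in\mathbb{F}_q\text{ for }1\le i\le k\}$, $G_0=H$; $H_0'=\{a_i=0\text{ unless } i=2(h-1)\text{ or } i\text{ odd}>h-1\}$; for $h$ odd $H'=\{a_i=0\text{ for odd } i\le h-1\}$; for $h$ even $H'=\{a_i=0\text{ for odd } i<h-1,\ a_{h-1}\in\mathbb{F}_q\}$ and $H_1'=\{a_i=0\text{ unless }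 i=2(h-1)\text{ or } i\text{ odd}\ge h-1;\ a_{h-1}\in\mathbb{F}_q\}$. An additive character $\psi$ of $\mathbb{F}_{q^2}$ has conductor $q^2$ if there is $x$ with $\psi(x^q)\ne\psi(x)$. Let $\psi(a)=\chi(1+a\tau^{2(h-1)})$ and $\widetilde\psi(1+\sum a_i\tau^i)=\psi(a_{2(h-1)})$ on $H_0'$. Definition of $\rho_\chi$: if $h$ is odd, $\chi^\sharp(1+\sum a_i\tau^i)=\chi(1+\sum_{i=1}^{h-1}a_{2i}\tau^{2i})$ is a character of $H'$ and $\rho_\chi=\mathrm{Ind}_{H'}^{\mathcal U}\chi^\sharp$; if $h$ is even, choose a character $\theta$ of $H_1'$ extending $\widetilde\psi$, let $\widetilde\chi_\theta(kn)=\chi(k)\theta(n)$ ($k\in H$, $n\in H_1'$), a well-defined character of $H'$, and $\rho_\chi=\mathrm{Ind}_{H'}^{\mathcal U}\widetilde\chi_\theta$ (its isomorphism class is independent of $\theta$). *)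

(* Defs.v *)
From HB Require Import structures.
From mathcomp Require Import all_boot all_order all_algebra all_fingroup all_solvable all_field all_character.
Set Implicit Arguments. Unset Strict Implicit. Unset Printing Implicit Defensive.
Import GRing.Theory Num.Theory.
Local Open Scope ring_scope.

(* The group U_h^{2,q}(F) (F = F_{q^2}) is realised as the
   group of matrices of right multiplication on the truncated twisted
   polynomial ring F{tau}/(tau^{n+1}), n = 2(h-1), acting on row vectors
   of coefficients (c_0,...,c_n):  the element u = 1 + sum_{i=1}^n a_i tau^i
   is sent to the (n+1)x(n+1) matrix M_u with
       M_u (k,l) = (a_{l-k})^(q^k)  if k <= l   (a_0 := 1),   0 otherwise.
   Then M_u *m M_v = M_{uv}, so u |-> M_u is an injective group morphism. *)

Section Ugroup.
Variables (F : finFieldType) (q h : nat).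

Definition Un := (2 * (h - 1))%N.

(* a : {ffun 'I_Un -> F} stores a_i (1 <= i <= Un) at index i-1. *)
Definition ucoef (a : {ffun 'I_Un -> F}) (i : nat) : F :=
  if i == 0%N then 1 else
  if insub i.-1 is Some j then a j else 0.

Definition Umat (a : {ffun 'I_Un -> F}) : 'M[F]_(Un.+1) :=
  \matrix_(k, l) if (k <= l)%N then ucoef a (l - k) ^+ (q ^ k) else 0.

Definition gT := {'GL_(Un.+1)[F]}.

Definition gcoef (g : gT) (i : nat) : F := GLval g ord0 (inord i).

Definition inFq (x : F) : bool := x ^+ q == x.

Definition Usub (P : {ffun 'I_Un -> F} -> bool) : {group gT} :=
  (<< [set g : gT | [exists a, P a && (GLval g == Umat a)]] >>)%G.

Definition in1n (i : nat) := (1 <= i <= Un)%N.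

Definition UU := Usub (fun _ => true).
Definition HH := Usub (fun a => [forall i : 'I_Un.+1, (in1n i && odd i) ==> (ucoef a i == 0)]).
Definition Htop := Usub (fun a => [forall i : 'I_Un.+1, (in1n i && (i != Un :> nat)) ==> (ucoef a i == 0)]).
Definition GG (k : nat) := Usub (fun a =>
  [forall i : 'I_Un.+1, (in1n i && odd i) ==> (ucoef a i == 0)] &&
  [forall i : 'I_Un.+1, (1 <= i <= k)%N ==> inFq (ucoef a (2 * i))]).
Definition H0' := Usub (fun a =>
  [forall i : 'I_Un.+1, (in1n i && ~~ ((i == Un :> nat) || (odd i && (h - 1 < i)%N))) ==> (ucoef a i == 0)]).
Definition H' := Usub (fun a =>
  if odd h then [forall i : 'I_Un.+1, (in1n i && odd i && (i <= h - 1)%N) ==> (ucoef a i == 0)]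
  else [forall i : 'I_Un.+1, (in1n i && odd i && (i < h - 1)%N) ==> (ucoef a i == 0)]
       && inFq (ucoef a (h - 1))).
Definition H1' := Usub (fun a =>
  [forall i : 'I_Un.+1, (in1n i && ~~ ((i == Un :> nat) || (odd i && (h - 1 <= i)%N))) ==> (ucoef a i == 0)]
  && inFq (ucoef a (h - 1))).

End Ugroup.

(* Main.v *)
Require Import Defs.
From HB Require Import structures.
From mathcomp Require Import all_boot all_order all_algebra all_fingroup all_solvable all_field all_character.
From mathcomp Require Import ring zify.
Set Implicit Arguments. Unset Strict Implicit. Unset Printing Implicit Defensive.
Import GRing.Theory Num.Theory.
Local Open Scope ring_scope.

(** Put X = tau^2, a central element, and write an element of U as E + O tau with
    E, O in F[X] truncated; tau E = bar E tau, where bar is the Frobenius x |-> x^q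
    on coefficients.  For g = E in H, put d = E - bar E; conjugating by 1 + y tau gives
      bar E + K d + K y d tau,    K = (1 - y (bar y) X)^-1.
    Hence rho_chi(g) is, up to the factor 1 / q^(h-1), the sum of the inducing character
    over those conjugates, for y in F[X] / X^(h-1), that lie in H'.
    Let k be the X-adic valuation of d.  If val y = j with 2j + 2 <= h - 1 - k, then
    replacing y by y + b X^(h-2-k-j) multiplies the summand by psi (x - x^q), with x a
    nonzero multiple of b, so these terms cancel.  The remaining y contribute the
    constant chi(g), or a Gauss type sum of psi (d_k x^(q+1)), which equals -q.  Thus
    rho_chi(g) = (-1)^(h-1-k) q^k chi(g); as g lies in G_i exactly when i < k, the right-hand
    side is a geometric sum with the same value. *)

(** * Divisibility by powers of X, and root counts in finite fields *)

Lemma dvdp_XnP (F : fieldType) (k : nat) (p : {poly F}) :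
  reflect (forall i, (i < k)%N -> p`_i = 0) ('X^k %| p).
Proof.
apply: (iffP idP) => [/dvdpP [u ->] i ik|p0]; first by rewrite coefMXn ik.
rewrite -(poly_take_drop k p) (_ : take_poly k p = 0) ?add0r ?dvdp_mull //.
apply/polyP => i; rewrite coef_take_poly coef0; case: ifP => // ik.
exact: p0.
Qed.

(** Since ['X^#|F| - 'X] is the product of the distinct [X - x], a monic divisor is a subproduct,
    and its degree counts its roots. *)
Lemma card_root_monic (F : finFieldType) (P : {poly F}) :
  P \is monic -> P %| ('X^#|F| - 'X) -> #|[set x | root P x]| = (size P).-1.
Proof.
rewrite finField_genPoly => Pm /dvdp_prod_XsubC [m].
set r := index_enum F.
rewrite eqp_monic ?monic_prod_XsubC // => /eqP eP; rewrite {}eP.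
rewrite size_prod_XsubC /= -(card_uniqP _); last first.
  by rewrite mask_uniq // index_enum_uniq.
by apply: eq_card => x; rewrite inE root_prod_XsubC.
Qed.

(** * Characters of F and the norm to the fixed field *)

Section Twist.
Variables (F : finFieldType) (q : nat) (s : {rmorphism F -> F}).
Hypotheses (sE : forall x, s x = x ^+ q) (cardF : #|F| = (q ^ 2)%N).

Lemma q_gt1 : (1 < q)%N.
Proof. by have := finNzRing_gt1 F; rewrite cardF; case: q => [|[|]]. Qed.

Lemma twistK : involutive s.
Proof. by move=> x; rewrite !sE -exprM mulnn -cardF expf_card. Qed.

Lemma twistX x k : x ^+ (q ^ k) = if odd k then s x else x.
Proof.
elim: k => [|k IHk]; first by rewrite expr1.
by rewrite expnSr exprM IHk -sE /=; case: (odd k); rewrite ?twistK.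
Qed.

Lemma genPolyE : 'X^#|F| - 'X = 'X * ('X^(q.-1 * q.+1) - 1) :> {poly F}.
Proof.
have := q_gt1; rewrite cardF mulrBr mulr1 -exprS.
by case: q => [|[|n]] // _; congr ('X^_ - _) => /=; lia.
Qed.

Lemma card_fixed : #|[set x : F | s x == x]| = q.
Proof.
have q1 := q_gt1.
have sz : size ('X^q - 'X : {poly F}) = q.+1.
  by rewrite size_polyDl size_polyXn // size_polyN size_polyX.
rewrite -[RHS]/(q.+1.-1) -sz -card_root_monic.
- by apply: eq_card => x; rewrite !inE rootE !hornerE sE subr_eq0.
- by rewrite monicE lead_coefDl ?lead_coefXn // size_polyXn size_polyN size_polyX.
have -> : 'X^q - 'X = 'X * ('X^(q.-1) - 1) :> {poly F}.
  by rewrite mulrBr mulr1 -exprS prednK // ltnW.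
by rewrite genPolyE dvdp_mul // exprM [X in _ %| X]subrX1 dvdp_mulIl.
Qed.

(** A nonzero t in F_q has t^(q-1) = 1, so X^(q+1) - t divides (X^(q+1))^(q-1) - t^(q-1) = X^(q^2-1)
    - 1 and has q + 1 distinct roots. *)
Lemma card_norm_fiber t : s t = t -> t != 0 -> #|[set x | x * s x == t]| = q.+1.
Proof.
move=> st t0; have q1 := q_gt1.
have sz : size ('X^(q.+1) - t%:P : {poly F}) = q.+2.
  by rewrite size_polyDl size_polyXn // size_polyN size_polyC t0.
rewrite -[RHS]/(q.+2.-1) -sz -card_root_monic.
- by apply: eq_card => x; rewrite !inE rootE !hornerE sE exprS subr_eq0.
- by rewrite monicE lead_coefDl ?lead_coefXn // size_polyXn size_polyN size_polyC t0.
have tq : t ^+ q.-1 = 1.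
  by apply: (mulfI t0); rewrite -exprS prednK 1?ltnW // -sE st mulr1.
rewrite genPolyE dvdp_mull // mulnC exprM -(polyC1) -tq rmorphXn /= subrXX.
exact: dvdp_mulIl.
Qed.

Lemma sum_char_nontriv (V : finZmodType) (f : V -> algC) v :
  {morph f : x y / x + y >-> x * y} -> f v != 1 -> \sum_x f x = 0.
Proof.
move=> fD fv; have : f v * (\sum_x f x) = \sum_x f x.
  rewrite mulr_sumr [RHS](reindex_inj (addrI v)).
  by apply: eq_bigr => x _; rewrite fD.
move/eqP; rewrite -subr_eq0 -{2}[\sum_x _]mul1r -mulrBl mulf_eq0 subr_eq0.
by rewrite (negPf fv) => /eqP.
Qed.

Variables (psi : F -> algC).
Hypotheses (psiD : {morph psi : x y / x + y >-> x * y}).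
Hypothesis psi_cond : exists a, psi (a - s a) != 1.

Lemma sum_psi_trace c : c != 0 -> \sum_b psi (c * b - s (c * b)) = 0.
Proof.
have [a a1] := psi_cond => c0.
apply: (@sum_char_nontriv _ _ (a / c)); last by rewrite mulrC divfK.
by move=> x y; rewrite -psiD mulrDr rmorphD /= opprD addrACA.
Qed.

Lemma sum_psi_fixed d : d != 0 -> s d = - d ->
  \sum_(t | s t == t) psi (d * t) = 0.
Proof.
have [a a1] := psi_cond => d0 sd.
(* [s] negates numerator and denominator, so [v] is fixed by [s]; translation by it permutes the
   indices and multiplies the sum by [psi (a - s a)], which is not 1. *)
pose v := (a - s a) / d.
have sv : s v = v by rewrite /v fmorph_div rmorphB /= twistK sd invrN mulrN -mulNr opprB.
have : psi (d * v) * (\sum_(t | s t == t) psi (d * t)) = \sum_(t | s t == t) psi (d * t).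
  rewrite mulr_sumr [RHS](reindex_inj (addrI v)).
  apply: eq_big => [x|x _]; last by rewrite mulrDr psiD.
  by rewrite rmorphD /= sv (inj_eq (addrI v)).
move/eqP; rewrite -subr_eq0 -{2}[\sum_(_ | _) _]mul1r -mulrBl mulf_eq0 subr_eq0.
by rewrite /v mulrC divfK // (negPf a1) => /eqP.
Qed.

(** Sort x by its norm t: one x lies over 0 and q + 1 over each nonzero t in F_q. By [sum_psi_fixed]
    the nonzero t sum to -1, whence 1 - (q + 1) = -q. *)
Lemma sum_psi_norm d : psi 0 = 1 -> d != 0 -> s d = - d ->
  \sum_x psi (d * (x * s x)) = - q%:R.
Proof.
move=> psi0 d0 sd.
rewrite (partition_big (fun x => x * s x) (fun t => s t == t)) /=; last first.
  by move=> x _; rewrite rmorphM /= twistK mulrC.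
have := sum_psi_fixed d0 sd.
rewrite !(bigD1 (P := fun t => s t == t) 0) ?rmorph0 //= mulr0 psi0.
move/eqP; rewrite addrC addr_eq0 => /eqP S1.
rewrite (big_pred1 0) => [|x]; last by rewrite mulf_eq0 fmorph_eq0 orbb.
rewrite mul0r mulr0 psi0.
under eq_bigr => t /andP[/eqP st t0].
  under eq_bigr => x /eqP -> do over.
  rewrite sumr_const -(cardsE (fun x => x * s x == t)) card_norm_fiber //.
  rewrite -mulr_natl; over.
by rewrite -mulr_sumr S1 -natr1; ring.
Qed.

End Twist.

(** * Twisted polynomials as matrices *)

Section TwistedPoly.
Variables (F : finFieldType) (s : {rmorphism F -> F}) (n : nat).

(** Stands for x^(q^k), which depends only on the parity of k ([twistX]). *)
Definition tw (k : nat) (x : F) : F := if odd k then s x else x.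

Lemma twB k : {morph tw k : x y / x - y}.
Proof. by move=> x y; rewrite /tw; case: ifP; rewrite ?rmorphB. Qed.
Lemma twM k : {morph tw k : x y / x * y}.
Proof. by move=> x y; rewrite /tw; case: ifP; rewrite ?rmorphM. Qed.
Lemma tw0 k : tw k 0 = 0. Proof. by rewrite /tw rmorph0 if_same. Qed.
Lemma tw1 k : tw k 1 = 1. Proof. by rewrite /tw rmorph1 if_same. Qed.

(** [Dm a] and [Tm] are right multiplication by the constant a and by tau on row vectors of
    coefficients. *)
Definition Dm (a : F) : 'M[F]_n.+1 := diag_mx (\row_k tw k a).
Definition Tm : 'M[F]_n.+1 := \matrix_(k, l) (l == k.+1 :> nat)%:R.

Fact Dm_zmod : zmod_morphism Dm.
Proof. by move=> a b; rewrite /Dm -raddfB; congr diag_mx; apply/rowP=> k; rewrite !mxE twB. Qed.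
Fact Dm_monoid : monoid_morphism Dm.
Proof.
split=> [|a b]; first by apply/matrixP=> i j; rewrite !mxE tw1.
rewrite /Dm -mulmxE mulmx_diag; congr diag_mx; apply/rowP=> k.
by rewrite !mxE twM.
Qed.
HB.instance Definition _ := GRing.isZmodMorphism.Build F 'M[F]_n.+1 Dm Dm_zmod.
HB.instance Definition _ := GRing.isMonoidMorphism.Build F 'M[F]_n.+1 Dm Dm_monoid.

Lemma TmX i k l : (Tm ^+ i) k l = (l == (k + i)%N :> nat)%:R.
Proof.
elim: i k l => [|i IHi] k l; first by rewrite expr0 mxE addn0 eq_sym.
rewrite exprS -mulmxE mxE.
under eq_bigr => j _ do rewrite IHi mxE.
have [kn|kn] := ltnP k n.
  rewrite (bigD1 (Ordinal (kn : k.+1 < n.+1)%N)) //= eqxx mul1r addSnnS.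
  rewrite big1 ?addr0 // => j; rewrite -val_eqE /= => /negPf ->.
  by rewrite mul0r.
rewrite big1 => [|j _].
  by rewrite ltn_eqF //; have := ltn_ord l; lia.
by rewrite ltn_eqF ?mul0r //; have := ltn_ord j; lia.
Qed.

Hypothesis sK : involutive s.

Lemma TmD a : Tm * Dm a = Dm (s a) * Tm.
Proof.
rewrite -!mulmxE /Dm mul_mx_diag mul_diag_mx; apply/matrixP => k l.
rewrite !mxE; case: eqP => [->|_]; last by rewrite mul0r mulr0.
by rewrite mulrC /tw /= sK; case: odd.
Qed.

Fact TmD2 : commr_rmorph Dm (Tm ^+ 2).
Proof. by move=> a; rewrite /GRing.comm expr2 -mulrA TmD mulrA TmD sK mulrA. Qed.

(** Evaluation at X = tau^2, a ring morphism because tau^2 commutes with the constants. *)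
Definition phi : {poly F} -> 'M[F]_n.+1 := horner_morph TmD2.
HB.instance Definition _ := GRing.RMorphism.on phi.

Lemma phiX : phi 'X = Tm ^+ 2. Proof. exact: horner_morphX. Qed.
Lemma phiC a : phi a%:P = Dm a. Proof. exact: horner_morphC. Qed.

Lemma Tm_phi p : Tm * phi p = phi (map_poly s p) * Tm.
Proof.
elim/poly_ind: p => [|p c IHp]; first by rewrite !rmorph0 mulr0 mul0r.
rewrite !(rmorphD, rmorphM) /= map_polyX map_polyC /= mulrDr mulrDl.
rewrite !phiX !phiC TmD mulrA IHp.
by rewrite -(mulrA _ Tm) -(mulrA _ _ Tm) -exprS -exprSr.
Qed.

Lemma phiE p k l :
  phi p k l = if (k <= l)%N && ~~ odd (l - k) then tw k p`_(l - k)./2 else 0.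
Proof.
rewrite /phi /horner_morph horner_coef size_map_poly summxE.
under eq_bigr => i _.
  rewrite coef_map -exprM -mulmxE /= /Dm mul_diag_mx mxE TmX mxE; over.
case: ifP => [/andP[kl odd_kl]|kl]; last first.
  rewrite big1 // => i _; case: eqP => [e|_]; last by rewrite mulr0.
  by move: kl; rewrite e leq_addr addKn mul2n odd_double.
have [ps|ps] := leqP (size p) (l - k)./2.
  rewrite nth_default // tw0 big1 // => i _; case: eqP => [e|_]; last by rewrite mulr0.
  by have := leq_trans (ltn_ord i) ps; rewrite e addKn mul2n doubleK ltnn.
rewrite (bigD1 (Ordinal ps)) //= big1 => [|i].
  by rewrite addr0 (_ : (_ == _) = true) ?mulr1 //; apply/eqP; lia.
rewrite -val_eqE /= => ne; case: eqP => [e|_]; last by rewrite mulr0.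
by case/eqP: ne; rewrite e addKn mul2n doubleK.
Qed.

Definition mat (E O : {poly F}) : 'M[F]_n.+1 := phi E + phi O * Tm.

(** Moving tau to the right past E' or O' applies bar to it, and the tau^2 left over is X. *)
Lemma matM E O E' O' : mat E O * mat E' O' =
  mat (E * E' + O * map_poly s O' * 'X) (E * O' + O * map_poly s E').
Proof.
rewrite /mat !(rmorphD, rmorphM) /= phiX !mulrDl !mulrDr.
have -> : phi O * Tm * phi E' = phi O * phi (map_poly s E') * Tm.
  by rewrite -!mulrA Tm_phi.
have -> : phi O * Tm * (phi O' * Tm) = phi O * phi (map_poly s O') * Tm ^+ 2.
  by rewrite -!mulrA (mulrA Tm) Tm_phi -mulrA -expr2.
by rewrite mulrA -!addrA [X in _ = _ + X]addrC !addrA.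
Qed.

Lemma matE E O k l : mat E O k l =
  if (k <= l)%N then tw k (if odd (l - k) then O else E)`_(l - k)./2 else 0.
Proof.
have e : (phi O * Tm) k l =
    if (k < l)%N && odd (l - k) then tw k O`_(l - k)./2 else 0.
  rewrite -mulmxE mxE; case: l => [[|l] lP] /=.
    by rewrite big1 // => j _; rewrite !mxE /= mulr0.
  rewrite (bigD1 (Ordinal (ltnW lP : l < n.+1)%N)) //= big1 => [|j].
    rewrite !mxE /= eqxx mulr1 addr0 phiE /= ltnS.
    case: leqP => //= kl; rewrite subSn //=; case: ifP => // o.
    by congr (tw _ _`__); move: o; lia.
  rewrite -val_eqE /= => ne; rewrite !mxE; case: eqP => [[e]|]; last by rewrite mulr0.
  by case/eqP: ne.
rewrite /mat mxE e phiE; case: ltngtP => [kl|lk|/val_inj ->] /=.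
- by case: odd; rewrite /= ?addr0 ?add0r.
- by rewrite addr0.
by rewrite subnn addr0.
Qed.

End TwistedPoly.

Lemma polyXn_sub_coef (F : fieldType) (k i : nat) (p q : {poly F}) :
  'X^k %| p - q -> (i < k)%N -> p`_i = q`_i.
Proof. by move/dvdp_XnP=> pq /pq /eqP; rewrite coefB subr_eq0 => /eqP. Qed.

(** * Elements E + O tau of U, and subgroups cut out by conditions on coefficients *)

Section Group.
Variables (F : finFieldType) (q h : nat) (s : {rmorphism F -> F}).
Hypotheses (sE : forall x, s x = x ^+ q) (cardF : #|F| = (q ^ 2)%N).
Hypothesis h2 : (2 <= h)%N.

Local Notation sK := (twistK sE cardF).
Local Notation bar := (map_poly s).
Local Notation N := (h - 1)%N.
Implicit Types (E O : {poly F}) (P : {ffun 'I_(Un h) -> F} -> bool).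

Lemma GLval_inj (g g' : gT F h) : GLval g = GLval g' -> g = g'.
Proof. by move/val_inj. Qed.

Lemma GLvalM (g g' : gT F h) : GLval (g * g')%g = GLval g * GLval g'.
Proof. by []. Qed.

Lemma barK : involutive bar.
Proof. by move=> p; apply/polyP=> i; rewrite !coef_map /= sK. Qed.

(* The coefficient a_(2i) is E`_i and a_(2i+1) is O`_i; entry j stores a_(j+1). *)
Definition coefs_of (E O : {poly F}) : {ffun 'I_(Un h) -> F} :=
  [ffun j : 'I_(Un h) => (if odd j.+1 then O else E)`_(j.+1)./2].

Lemma ucoef_coefs_of E O i : E`_0 = 1 -> (i <= Un h)%N ->
  ucoef (coefs_of E O) i = (if odd i then O else E)`_i./2.
Proof.
move=> E0; rewrite /ucoef; case: i => [|i] //= iU.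
by rewrite insubT ffunE.
Qed.

Lemma Umat_coefs_of E O : E`_0 = 1 -> Umat q (coefs_of E O) = mat (Un h) sK E O.
Proof.
move=> E0; apply/matrixP => k l; rewrite mxE matE; case: ifP => // kl.
rewrite ucoef_coefs_of //; last by have := ltn_ord l; rewrite ltnS; apply: leq_trans (leq_subr _ _).
exact: (twistX sE cardF).
Qed.

Lemma coefs_of_surj a : exists E O, E`_0 = 1 /\ a = coefs_of E O.
Proof.
exists (\poly_(i < h) ucoef a (2 * i)), (\poly_(i < h) ucoef a (2 * i).+1).
split=> [|]; first by rewrite coef_poly muln0 /ucoef eqxx; case: h h2.
apply/ffunP => j; have := ltn_ord j; rewrite {2}/Un ffunE => jU.
have e : a j = ucoef a j.+1 by rewrite /ucoef /= valK.
by rewrite e; case: ifP => o; rewrite coef_poly ifT; try (congr ucoef; move: o); lia.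
Qed.

(** The default 1 is reached only when the matrix is singular, which cannot happen once E has
    constant coefficient 1 ([val_gU]). *)
Definition gU (E O : {poly F}) : gT F h :=
  insubd (1%g : gT F h) (mat (Un h) sK E O).

Lemma val_gU E O : E`_0 = 1 -> GLval (gU E O) = mat (Un h) sK E O.
Proof.
move=> E0; have u : mat (Un h) sK E O \in unitmx.
  rewrite unitmxE -det_tr det_trig.
    rewrite big1 ?unitr1 // => i _; rewrite mxE matE leqnn subnn /= E0.
    exact: tw1.
  by apply/is_trig_mxP => i j ij; rewrite mxE matE leqNgt ij.
exact: (insubdK (1%g : gT F h) u).
Qed.

Lemma gU_coef0 E O E' O' : E`_0 = 1 -> E'`_0 = 1 ->
  (E * E' + O * bar O' * 'X)`_0 = 1.
Proof. by move=> E0 E0'; rewrite coefD coefMX coef0M E0 E0' mulr1 addr0. Qed.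

Lemma gU_mul E O E' O' : E`_0 = 1 -> E'`_0 = 1 ->
  (gU E O * gU E' O')%g = gU (E * E' + O * bar O' * 'X) (E * O' + O * bar E').
Proof.
move=> E0 E0'; apply: GLval_inj; rewrite GLvalM !val_gU ?gU_coef0 //.
exact: matM.
Qed.

Lemma gcoef_gU E O i : E`_0 = 1 -> (i <= Un h)%N ->
  gcoef (gU E O) i = (if odd i then O else E)`_i./2.
Proof. by move=> E0 iU; rewrite /gcoef val_gU // matE inordK //= subn0. Qed.

Lemma gcoef_top E O : E`_0 = 1 -> gcoef (gU E O) (Un h) = E`_N.
Proof. by move=> E0; rewrite gcoef_gU // /Un mul2n odd_double doubleK. Qed.

(** Coefficients stop at the even power tau^(2(h-1)), so E counts modulo X^h but O only modulo
    X^(h-1). *)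
Lemma gU_eqP E O E' O' : E`_0 = 1 -> E'`_0 = 1 ->
  gU E O = gU E' O' <-> ('X^h %| E - E') && ('X^N %| O - O').
Proof.
move=> E0 E0'; split=> [e|/andP[eE eO]].
  apply/andP; split; apply/dvdp_XnP => i ih; rewrite coefB; apply/eqP; rewrite subr_eq0; apply/eqP.
    have := congr1 (fun g => gcoef g i.*2) e.
    by rewrite !gcoef_gU ?odd_double ?doubleK // /Un; lia.
  have := congr1 (fun g => gcoef g i.*2.+1) e.
  by rewrite !gcoef_gU //= ?odd_double /= ?uphalf_double // /Un; lia.
apply: GLval_inj; rewrite !val_gU //.
apply/matrixP => k l; rewrite !matE; case: ifP => // kl; congr (tw _ _ _).
have := ltn_ord l; rewrite {2}/Un => lU.
by case: ifP => o; [apply: (polyXn_sub_coef eO)|apply: (polyXn_sub_coef eE)]; lia.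
Qed.

Lemma gU_eq E O E' O' : E`_0 = 1 -> E'`_0 = 1 ->
  'X^h %| E - E' -> 'X^N %| O - O' -> gU E O = gU E' O'.
Proof. by move=> E0 E0' eE eO; apply/gU_eqP => //; rewrite eE. Qed.

Lemma coefs_of_eq E O E' O' : E`_0 = 1 -> E'`_0 = 1 ->
  gU E O = gU E' O' -> coefs_of E O = coefs_of E' O'.
Proof.
move=> E0 E0' e; apply/ffunP => i; have := congr1 (fun g => gcoef g i.+1) e.
by rewrite !gcoef_gU ?ffunE // ltn_ord.
Qed.

Lemma gU1 : gU 1 0 = 1%g.
Proof.
apply: GLval_inj; rewrite val_gU ?coef1 //.
by rewrite /mat rmorph0 mul0r addr0 rmorph1.
Qed.

Definition closedP P :=
  P (coefs_of 1 0) /\ forall E O E' O', E`_0 = 1 -> E'`_0 = 1 ->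
    P (coefs_of E O) -> P (coefs_of E' O') ->
    P (coefs_of (E * E' + O * bar O' * 'X) (E * O' + O * bar E')).

Lemma mem_Usub P E O :
  E`_0 = 1 -> P (coefs_of E O) -> gU E O \in Usub q P.
Proof.
move=> E0 PE; apply: mem_gen; rewrite inE; apply/existsP; exists (coefs_of E O).
by rewrite PE Umat_coefs_of // val_gU //=.
Qed.

(** In a finite group, closure under 1 and products suffices, so generating a subgroup adds nothing
    to the set cut out by [P]. *)
Lemma UsubP P g : closedP P ->
  reflect (exists E O, [/\ E`_0 = 1, P (coefs_of E O) & g = gU E O]) (g \in Usub q P).
Proof.
move=> [P1 PM]; apply: (iffP idP) => [|[E [O [E0 PE ->]]]]; last exact: mem_Usub.
set A := [set g : gT F h | [exists a, P a && (GLval g == Umat q a)]].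
have AP x : reflect (exists E O, [/\ E`_0 = 1, P (coefs_of E O) & x = gU E O]) (x \in A).
  rewrite inE; apply: (iffP existsP) => [[a /andP[Pa /eqP xa]]|[E [O [E0 PE ->]]]].
    have [E [O [E0 ea]]] := coefs_of_surj a; exists E, O; split=> //; rewrite -?ea //.
    by apply: GLval_inj; rewrite xa ea Umat_coefs_of // val_gU.
  by exists (coefs_of E O); rewrite PE Umat_coefs_of // val_gU //=.
rewrite /Usub /= gen_set_id; first by move/AP.
apply/group_setP; split=> [|x y].
  by apply/AP; exists 1, 0; rewrite gU1 coef1.
move=> /AP[E [O [E0 PE ->]]] /AP[E' [O' [E0' PE' ->]]]; apply/AP.
exists (E * E' + O * bar O' * 'X), (E * O' + O * bar E').
by rewrite gU_mul //; split; [exact: gU_coef0|exact: PM|].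
Qed.

Lemma gU_in P E O : closedP P -> E`_0 = 1 ->
  (gU E O \in Usub q P) = P (coefs_of E O).
Proof.
move=> Pc E0; apply/idP/idP => [/(UsubP _ Pc)[E' [O' [E0' PE /(coefs_of_eq E0 E0') ->]]]|] => //.
exact: mem_Usub.
Qed.

End Group.

(** * The subgroups of U in terms of E + O tau *)

Section Subgroups.
Variables (F : finFieldType) (q h : nat) (s : {rmorphism F -> F}).
Hypothesis h2 : (2 <= h)%N.

Local Notation bar := (map_poly s).
Local Notation N := (h - 1)%N.
Implicit Types (E O : {poly F}) (P : {ffun 'I_(Un h) -> F} -> bool).

(** One formula for both parities of h: the odd indices 2i + 1 to be killed are those with i < N./2,
    and for even h the index h - 1 = 2 N./2 + 1 carries the coefficient required to lie in F_q. *)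
Definition inH' (O : {poly F}) : bool :=
  ('X^(N./2) %| O) && (odd h || (s O`_(N./2) == O`_(N./2))).

Lemma dvdp_bar k (p : {poly F}) : ('X^k %| bar p) = ('X^k %| p).
Proof.
apply/dvdp_XnP/dvdp_XnP => p0 i /p0; last by rewrite coef_map /= => ->; rewrite rmorph0.
by rewrite coef_map /= => /eqP; rewrite fmorph_eq0 => /eqP.
Qed.

(** The exponent h./2 is N./2 for odd h and N./2 + 1 for even h, which takes in the F_q coefficient
    as well. *)
Lemma inH'_mod O O' : 'X^(h./2) %| O - O' -> inH' O = inH' O'.
Proof.
move=> d; have d2 : 'X^(N./2) %| O - O' by apply: dvdp_trans d; rewrite dvdp_exp2l //; lia.
rewrite /inH'; have -> : ('X^(N./2) %| O) = ('X^(N./2) %| O').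
  by rewrite -[O](subrK O') dvdp_addr.
case: (boolP (odd h)) => //= ho; rewrite (polyXn_sub_coef d) //; lia.
Qed.

Lemma inH'_dvd O : 'X^(h./2) %| O -> inH' O.
Proof.
rewrite -{1}[O]subr0 => /inH'_mod ->.
by rewrite /inH' dvdp0 coef0 rmorph0 eqxx orbT.
Qed.

Lemma inH'_closed E O E' O' : E`_0 = 1 -> E'`_0 = 1 -> inH' O -> inH' O' ->
  inH' (E * O' + O * bar E').
Proof.
move=> E0 E0' /andP[d c] /andP[d' c']; rewrite /inH' (dvdp_add (dvdp_mull _ d') (dvdp_mulr _ d)) /=.
case: (boolP (odd h)) c c' => //= _ /eqP c /eqP c'.
have mid (p r : {poly F}) : r`_0 = 1 -> 'X^(N./2) %| p -> (r * p)`_(N./2) = p`_(N./2).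
  move=> r0 /dvdpP[u ->]; rewrite mulrA !coefMXn ltnn subnn.
  by rewrite coef0M r0 mul1r.
have bE0 : (bar E')`_0 = 1 by rewrite coef_map /= E0' rmorph1.
rewrite coefD mid // [O * _]mulrC mid //.
by rewrite rmorphD c c'.
Qed.

Lemma forall_ucoefP (c : nat -> bool) E O : E`_0 = 1 ->
  reflect (forall i, (i <= Un h)%N -> c i -> (if odd i then O else E)`_i./2 = 0)
    [forall i : 'I_(Un h).+1, c i ==> (ucoef (coefs_of h E O) i == 0)].
Proof.
move=> E0; apply: (iffP forallP) => [H i iU ci|H i].
  have := H (Ordinal (iU : i < (Un h).+1)%N); rewrite /= ci /= => /eqP.
  by rewrite ucoef_coefs_of.
have iU : (i <= Un h)%N by rewrite -ltnS.
by apply/implyP => /(H _ iU) e; rewrite ucoef_coefs_of // e.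
Qed.

Lemma odd_zeroP E O (c : nat -> bool) m : E`_0 = 1 -> (m <= N)%N ->
  (forall i, c i -> odd i /\ (i./2 < m)%N) ->
  (forall i, (i < m)%N -> c i.*2.+1) ->
  [forall i : 'I_(Un h).+1, c i ==> (ucoef (coefs_of h E O) i == 0)] = ('X^m %| O).
Proof.
move=> E0 mN c1 c2; apply/(forall_ucoefP _ _ E0)/dvdp_XnP => [H i im|H i iU /c1[oi im]].
  have := H i.*2.+1; rewrite /= odd_double /= uphalf_double; apply; last exact: c2.
  by rewrite /Un; lia.
by rewrite oi; apply: H.
Qed.

Hypotheses (sE : forall x, s x = x ^+ q) (cardF : #|F| = (q ^ 2)%N).

Local Notation gU := (gU h sE cardF).

(** The predicates of [HH], [GG], [H'] and [Htop] get names so that [closedP] can be stated for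
    them; each group is convertible to [Usub] of its predicate. *)
Definition PH (a : {ffun 'I_(Un h) -> F}) :=
  [forall i : 'I_(Un h).+1, (in1n h i && odd i) ==> (ucoef a i == 0)].
Definition PG k (a : {ffun 'I_(Un h) -> F}) := PH a &&
  [forall i : 'I_(Un h).+1, (1 <= i <= k)%N ==> inFq q (ucoef a (2 * i))].
Definition PH' (a : {ffun 'I_(Un h) -> F}) :=
  if odd h then [forall i : 'I_(Un h).+1,
    (in1n h i && odd i && (i <= h - 1)%N) ==> (ucoef a i == 0)]
  else [forall i : 'I_(Un h).+1, (in1n h i && odd i && (i < h - 1)%N) ==> (ucoef a i == 0)]
       && inFq q (ucoef a (h - 1)).
Definition Ptop (a : {ffun 'I_(Un h) -> F}) :=
  [forall i : 'I_(Un h).+1, (in1n h i && (i != Un h :> nat)) ==> (ucoef a i == 0)].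

Lemma PH_coefs_of E O : E`_0 = 1 -> PH (coefs_of h E O) = ('X^N %| O).
Proof.
move=> E0; apply: (@odd_zeroP E O (fun i => in1n h i && odd i) _ E0) => //= i;
  rewrite /in1n /Un; lia.
Qed.

(** A coefficient of E lies in F_q exactly when that of E - bar E vanishes; the exponent is k + 1
    because the constant coefficient is counted too. *)
Lemma PG_coefs_of k E O : E`_0 = 1 -> (k < h)%N ->
  PG k (coefs_of h E O) = ('X^N %| O) && ('X^(k.+1) %| E - bar E).
Proof.
move=> E0 kh; rewrite /PG PH_coefs_of //; congr (_ && _).
have u i : (i <= k)%N -> ucoef (coefs_of h E O) (2 * i) = E`_i.
  by move=> ik; rewrite mul2n ucoef_coefs_of ?odd_double ?doubleK // /Un; lia.
apply/forallP/dvdp_XnP => [H i ik|H i].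
  have iU : (i < (Un h).+1)%N by rewrite /Un; lia.
  have := H (Ordinal iU); rewrite /= coefB coef_map /inFq u //= -sE.
  case: i ik {iU} => [|i] /= ik; rewrite ?E0 ?rmorph1 ?subrr // => /implyP/(_ ik)/eqP ->.
  by rewrite subrr.
apply/implyP => /andP[i0 ik]; rewrite /inFq u // -sE eq_sym -subr_eq0.
by have := H i ik; rewrite coefB coef_map /= => ->.
Qed.

Lemma PH'_coefs_of E O : E`_0 = 1 -> PH' (coefs_of h E O) = inH' O.
Proof.
move=> E0; rewrite /PH' /inH'; case: ifP => ho /=.
  rewrite andbT.
  apply: (@odd_zeroP E O (fun i => in1n h i && odd i && (i <= h - 1)%N) _ E0) => //= [|i|i];
  rewrite /in1n /Un; lia.
congr (_ && _).
  apply: (@odd_zeroP E O (fun i => in1n h i && odd i && (i < h - 1)%N) _ E0) => //= [|i|i];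
  rewrite /in1n /Un; lia.
rewrite /inFq ucoef_coefs_of // -?sE; last by rewrite /Un; lia.
by rewrite (_ : odd _ = true) //; lia.
Qed.

Lemma Ptop_coefs_of E O : E`_0 = 1 -> Ptop (coefs_of h E O) = ('X^N %| O) && ('X^N %| E - 1).
Proof.
move=> E0; apply/(forall_ucoefP (fun i => in1n h i && (i != Un h)) _ E0)/andP.
  move=> H; split; apply/dvdp_XnP => i iN.
    by have := H i.*2.+1; rewrite /= odd_double /= uphalf_double; apply; rewrite /in1n /Un; lia.
  rewrite coefB coef1; case: i iN => [|i] iN; first by rewrite E0 subrr.
  by have := H i.+1.*2; rewrite odd_double doubleK subr0; apply; rewrite /in1n /Un; lia.
move=> [/dvdp_XnP HO /dvdp_XnP HE] i iU; rewrite /in1n /Un => ic.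
case: ifP => o; first by apply: HO; lia.
have := HE i./2; rewrite coefB coef1 (_ : (_ == _) = false) ?subr0; last lia.
by apply; lia.
Qed.

Lemma PH_closed : closedP s PH.
Proof.
split=> [|E O E' O' E0 E0']; rewrite !PH_coefs_of ?coef1 ?dvdp0 ?gU_coef0 // => d d'.
by rewrite (dvdp_add (dvdp_mull _ d') (dvdp_mulr _ d)).
Qed.

Lemma PG_closed k : (k < h)%N -> closedP s (PG k).
Proof.
move=> kh; split=> [|E O E' O' E0 E0']; rewrite !PG_coefs_of ?coef1 ?gU_coef0 //.
  by rewrite dvdp0 rmorph1 subrr dvdp0.
move=> /andP[dO dE] /andP[dO' dE'].
rewrite (dvdp_add (dvdp_mull _ dO') (dvdp_mulr _ dO)) /=.
rewrite !(rmorphD, rmorphM) /= (barK sE cardF) map_polyX.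
have -> : E * E' + O * bar O' * 'X - (bar E * bar E' + bar O * O' * 'X) =
  (E - bar E) * E' + (E' - bar E') * bar E + 'X * (O * bar O' - bar O * O') by ring.
(* Both odd parts are divisible by X^N, so this term is already zero modulo X^h, and k + 1 <= h. *)
have d : 'X^(k.+1) %| 'X * (O * bar O' - bar O * O').
  apply: (@dvdp_trans _ 'X^h); first by rewrite dvdp_exp2l.
  rewrite (_ : h = N.+1) ?exprS ?dvdp_mul2l ?polyX_eq0 //; last lia.
  by rewrite dvdp_sub // dvdp_mulr // dvdp_bar.
by rewrite (dvdp_add (dvdp_add (dvdp_mulr _ dE) (dvdp_mulr _ dE')) d).
Qed.

Lemma PH'_closed : closedP s PH'.
Proof.
split=> [|E O E' O' E0 E0']; rewrite !PH'_coefs_of ?coef1 ?gU_coef0 //; last exact: inH'_closed.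
by rewrite inH'_dvd // dvdp0.
Qed.

Lemma Ptop_closed : closedP s Ptop.
Proof.
split=> [|E O E' O' E0 E0']; rewrite !Ptop_coefs_of ?coef1 ?gU_coef0 //.
  by rewrite dvdp0 subrr dvdp0.
move=> /andP[dO dE] /andP[dO' dE'].
rewrite (dvdp_add (dvdp_mull _ dO') (dvdp_mulr _ dO)) /=.
have -> : E * E' + O * bar O' * 'X - 1 = (E - 1) * E' + (E' - 1) + O * bar O' * 'X by ring.
by rewrite (dvdp_add (dvdp_add (dvdp_mulr _ dE) dE') (dvdp_mulr _ (dvdp_mulr _ dO))).
Qed.

Lemma in_HH E O : E`_0 = 1 -> (gU E O \in HH F q h) = ('X^N %| O).
Proof. by move=> E0; rewrite -[HH F q h]/(Usub q PH) gU_in ?PH_coefs_of //; exact: PH_closed. Qed.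

Lemma in_GG k E O : (k < h)%N -> E`_0 = 1 ->
  (gU E O \in GG F q h k) = ('X^N %| O) && ('X^(k.+1) %| E - bar E).
Proof.
move=> kh E0; rewrite -[GG F q h k]/(Usub q (PG k)) gU_in ?PG_coefs_of //.
exact: PG_closed.
Qed.

Lemma in_H' E O : E`_0 = 1 -> (gU E O \in H' F q h) = inH' O.
Proof.
move=> E0; rewrite -[H' F q h]/(Usub q PH') gU_in ?PH'_coefs_of //.
exact: PH'_closed.
Qed.

Lemma in_UU E O : E`_0 = 1 -> gU E O \in UU F q h.
Proof. by move=> E0; apply: mem_Usub. Qed.

Lemma top_coef0 (a : F) : (1 + a *: 'X^N : {poly F})`_0 = 1.
Proof.
rewrite coefD coef1 coefZ coefXn.
by case: h h2 => [|[|m]] // _; rewrite subn1 /= mulr0 addr0.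
Qed.

Lemma UUP g : g \in UU F q h -> exists E O : {poly F}, E`_0 = 1 /\ g = gU E O.
Proof.
have c : closedP s (fun _ : {ffun 'I_(Un h) -> F} => true) by split.
by move=> /(UsubP sE cardF h2 _ c)[E [O [E0 _ ->]]]; exists E, O.
Qed.

Lemma HHP g : g \in HH F q h -> exists2 E : {poly F}, E`_0 = 1 & g = gU E 0.
Proof.
move=> /(UsubP sE cardF h2 _ PH_closed)[E [O [E0]]]; rewrite PH_coefs_of // => dO ->.
by exists E => //; apply: gU_eq; rewrite ?subrr ?dvdp0 // subr0.
Qed.

Lemma H'P g : g \in H' F q h -> exists E O : {poly F}, [/\ E`_0 = 1, inH' O & g = gU E O].
Proof.
move=> /(UsubP sE cardF h2 _ PH'_closed)[E [O [E0]]]; rewrite PH'_coefs_of // => dO ->.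
by exists E, O.
Qed.

Lemma HtopP g : g \in Htop F q h -> g = gU (1 + gcoef g (Un h) *: 'X^N) 0.
Proof.
move=> /(UsubP sE cardF h2 _ Ptop_closed)[E [O [E0]]]; rewrite Ptop_coefs_of //.
move=> /andP[dO dE] ->; rewrite gcoef_top //.
apply: gU_eq; rewrite ?subr0 ?top_coef0 //.
apply/dvdp_XnP => i ih; rewrite coefB coefD coefZ coefXn.
have [->|ne] := eqVneq i N.
  by rewrite mulr1 coef1 (_ : (_ == _) = false) ?add0r ?subrr //; lia.
by rewrite mulr0 addr0 (polyXn_sub_coef dE) ?subrr //; lia.
Qed.

Lemma in_H1' O : inH' O -> ~~ odd h -> gU 1 O \in H1' F q h.
Proof.
move=> /andP[d] + ho; rewrite (negPf ho) /= => c; apply: mem_Usub; first by rewrite coef1.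
rewrite /inFq ucoef_coefs_of ?coef1 //; last by rewrite /Un; lia.
rewrite (_ : odd N = true) -?sE ?c ?andbT; last lia.
apply/(forall_ucoefP (fun i => in1n h i && ~~ ((i == Un h) || odd i && (N <= i)%N)));
  first by rewrite coef1.
move=> i iU; rewrite /in1n => ic; case: ifP => o.
  by move/dvdp_XnP: d; apply; lia.
by rewrite coef1 (_ : (_ == _) = false) //; lia.
Qed.

Lemma in_H0' O : 'X^(h./2) %| O -> gU 1 O \in H0' F q h.
Proof.
move=> d; apply: mem_Usub; first by rewrite coef1.
apply/(forall_ucoefP (fun i => in1n h i && ~~ ((i == Un h) || odd i && (N < i)%N)));
  first by rewrite coef1.
move=> i iU; rewrite /in1n => ic; case: ifP => o.
  by move/dvdp_XnP: d; apply; lia.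
by rewrite coef1 (_ : (_ == _) = false) //; lia.
Qed.

End Subgroups.

(** * Conjugation by 1 + y tau *)

Section Conj.
Variables (F : finFieldType) (q h : nat) (s : {rmorphism F -> F}).
Hypothesis h2 : (2 <= h)%N.

Local Notation bar := (map_poly s).
Local Notation N := (h - 1)%N.
Implicit Types (E O y d p z : {poly F}).

Lemma h_predK : h = N.+1.
Proof. by case: h h2 => [|m] // _; rewrite subn1. Qed.

(** The inverse of 1 - z modulo X^h when X divides z; [geo (nu y)] is the factor K. *)
Definition geo (z : {poly F}) : {poly F} := \sum_(i < h) z ^+ i.

Lemma geoE z : geo z = 1 + z * geo z - z ^+ h.
Proof. by have := subrX1 z h; rewrite -/(geo z) => e; rewrite -[z ^+ h](subrK 1) e; ring. Qed.

Lemma geo_dvd z : 'X %| z -> 'X^h %| z ^+ h.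
Proof. exact: dvdp_exp2r. Qed.

Lemma coef0_dvd z : 'X %| z -> z`_0 = 0.
Proof. by move/(@dvdp_XnP _ 1); apply. Qed.

Lemma geo_coef0 z : 'X %| z -> (geo z)`_0 = 1.
Proof.
move=> Xz; rewrite geoE !(coefB, coefD) coef0M (coef0_dvd Xz) mul0r addr0 coef1.
by rewrite (coef0_dvd (z := z ^+ h)) ?subr0 // h_predK exprS dvdp_mulr.
Qed.

Lemma dvdX_coef0 z : z`_0 = 0 -> 'X %| z.
Proof. by move=> z0; apply/(@dvdp_XnP _ 1) => -[]. Qed.

Lemma inv_modXh E : E`_0 = 1 -> exists2 V : {poly F}, V`_0 = 1 & 'X^h %| E * V - 1.
Proof.
move=> E0; have XE : 'X %| 1 - E by apply: dvdX_coef0; rewrite coefB coef1 E0 subrr.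
exists (geo (1 - E)); first by rewrite geo_coef0.
have -> : E * geo (1 - E) - 1 = - (1 - E) ^+ h.
  by rewrite -[(1 - E) ^+ h](subKr (1 + (1 - E) * geo (1 - E))) -geoE; ring.
by rewrite dvdpNr geo_dvd.
Qed.

(** The square of y tau, so that 1 - nu y = (1 + y tau)(1 - y tau). *)
Definition nu y : {poly F} := y * bar y * 'X.

Lemma nuX y : 'X %| nu y. Proof. exact: dvdp_mull. Qed.

Definition conj_even E y := bar E + geo (nu y) * (E - bar E).
Definition conj_odd E y := geo (nu y) * y * (E - bar E).

Lemma conj_even0 E y : E`_0 = 1 -> (conj_even E y)`_0 = 1.
Proof.
by move=> E0; rewrite /conj_even coefD coef0M coefB coef_map /= E0 rmorph1 subrr mulr0 addr0.
Qed.

Lemma dvdp_Xn_top (p : {poly F}) m : 'X^m %| p -> 'X^(m.+1) %| p - p`_m *: 'X^m.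
Proof.
move=> /dvdp_XnP pm; apply/dvdp_XnP => i im; rewrite coefB coefZ coefXn.
by have [->|ne] := eqVneq i m; rewrite ?mulr1 ?subrr // mulr0 pm ?subr0 //; lia.
Qed.

(** With d = E - bar E, the tail geo (nu y) - 1 - nu y starts with (nu y)^2, and (nu y)^2 d has
    order at least 2(2j + 1) + k >= h. What is left is E + (nu y) d, where (nu y) d has order at
    least N. *)
Lemma conj_even_small E y j k : 'X^j %| y -> 'X^k %| E - bar E ->
    (N <= j + j + 1 + k)%N -> (0 < k)%N ->
  'X^h %| conj_even E y - (E + (nu y * (E - bar E))`_N *: 'X^N).
Proof.
move=> jy kd jk k0; pose d := E - bar E.
have jn : 'X^(j + j + 1) %| nu y by rewrite /nu !exprD expr1 !dvdp_mul // dvdp_bar.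
have Nd : 'X^N %| nu y * d.
  by apply: (@dvdp_trans _ ('X^(j + j + 1) * 'X^k)); rewrite ?dvdp_mul // -exprD dvdp_exp2l.
have -> : conj_even E y - (E + (nu y * d)`_N *: 'X^N) =
   (nu y * d - (nu y * d)`_N *: 'X^N) + (geo (nu y) - 1 - nu y) * d.
  by rewrite /conj_even /d; ring.
rewrite dvdp_add //; first by rewrite {1}h_predK dvdp_Xn_top.
have -> : (geo (nu y) - 1 - nu y) * d = (nu y * nu y * d) * geo (nu y) - nu y ^+ h * d * (1 + nu y).
  by rewrite {1}geoE {1}geoE; ring.
rewrite dvdp_sub //; last by rewrite -mulrA dvdp_mulr // geo_dvd // nuX.
rewrite dvdp_mulr //.
apply: (@dvdp_trans _ ('X^(j + j + 1) * 'X^(j + j + 1) * 'X^k)).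
  by rewrite -!exprD dvdp_exp2l //; lia.
by rewrite !dvdp_mul.
Qed.

(** The order of y d is at least j + k, and 2(j + k) >= N because k >= 1. *)
Lemma conj_odd_small E y j k : 'X^j %| y -> 'X^k %| E - bar E ->
    (N <= j + j + 1 + k)%N -> (0 < k)%N ->
  'X^(h./2) %| conj_odd E y.
Proof.
move=> jy kd jk k0; rewrite /conj_odd -mulrA dvdp_mull //.
apply: (@dvdp_trans _ ('X^j * 'X^k)); last by rewrite dvdp_mul.
by rewrite -exprD dvdp_exp2l //; lia.
Qed.

Section Translate.
Variables (E y : {poly F}) (b : F) (j k t : nat).
Hypotheses (jy : 'X^j %| y) (kd : 'X^k %| E - bar E)
  (jkt : (j + k + 1 + t)%N = N) (jt : (j < t)%N).
Let y2 := y + b *: 'X^t.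
Let c := (E - bar E)`_k * (b * s y`_j + s b * y`_j).

(** Modulo X^h the two inverses differ by their product times nu y2 - nu y, which starts in degree 1
    + t + j; multiplied by d it starts in degree N, with coefficient [c]. *)
Lemma geo_translate : 'X^h %| (geo (nu y2) - geo (nu y)) * (E - bar E) - c *: 'X^N.
Proof.
have [y' ey] := dvdpP _ _ jy; have [d' ed] := dvdpP _ _ kd.
(* The cross terms of the norm form have the lowest degree, because j < t. *)
have nuE : nu y2 - nu y = 'X^(1 + t + j) * (b *: bar y' + s b *: y' + (b * s b) *: 'X^(t - j)).
  rewrite /nu /y2 ey rmorphD !rmorphM /= map_polyZ /= !map_polyXn.
  rewrite -!mul_polyC polyCM !exprD expr1.
  have -> : 'X^t = 'X^j * 'X^(t - j) :> {poly F} by rewrite -exprD subnKC 1?ltnW.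
  ring.
pose r := geo (nu y) * geo (nu y2) * d' * (b *: bar y' + s b *: y' + (b * s b) *: 'X^(t - j)).
have geoB : (geo (nu y2) - geo (nu y)) * (E - bar E) = 'X^N * r +
   (geo (nu y2) * nu y ^+ h - geo (nu y) * nu y2 ^+ h) * (E - bar E).
  have -> : (geo (nu y2) - geo (nu y)) =
    geo (nu y) * geo (nu y2) * (nu y2 - nu y) +
    (geo (nu y2) * nu y ^+ h - geo (nu y) * nu y2 ^+ h).
    have e1 := geoE (nu y); have e2 := geoE (nu y2).
    have {}e1 : nu y ^+ h = 1 + nu y * geo (nu y) - geo (nu y) by rewrite {2}e1; ring.
    have {}e2 : nu y2 ^+ h = 1 + nu y2 * geo (nu y2) - geo (nu y2) by rewrite {2}e2; ring.
    by rewrite e1 e2; ring.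
  rewrite mulrDl; congr (_ + _); rewrite nuE /r ed -jkt !exprD expr1; ring.
have r0 : r`_0 = c.
  have geo1 z : (geo (nu z))`_0 = 1 by rewrite geo_coef0 // nuX.
  rewrite /r !coef0M !geo1 !mul1r !coefD !coefZ coefXn coef_map /c ed ey.
  rewrite !coefMXn !ltnn !subnn (_ : (0%N == _) = false); last lia.
  by rewrite mulr0 addr0.
rewrite geoB addrAC dvdp_add //; last first.
  by rewrite dvdp_mulr // dvdp_sub // dvdp_mull // geo_dvd // nuX.
have -> : 'X^N * r - c *: 'X^N = 'X^N * (r - r`_0 *: 'X^0) by rewrite r0 -!mul_polyC expr0; ring.
by rewrite {1}h_predK exprSr dvdp_mul //; apply: (@dvdp_Xn_top r 0); rewrite expr0 dvd1p.
Qed.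

Lemma conj_even_translate : 'X^h %| conj_even E y2 - (conj_even E y + c *: 'X^N).
Proof.
have -> : conj_even E y2 - (conj_even E y + c *: 'X^N) =
  (geo (nu y2) - geo (nu y)) * (E - bar E) - c *: 'X^N by rewrite /conj_even; ring.
exact: geo_translate.
Qed.

(** The change of y itself contributes a multiple of b X^t d, of order at least t + k; and t + k >=
    h./2 follows from j < t and j + k + 1 + t = N. *)
Lemma conj_odd_translate : 'X^(h./2) %| conj_odd E y2 - conj_odd E y.
Proof.
have -> : conj_odd E y2 - conj_odd E y = ((geo (nu y2) - geo (nu y)) * (E - bar E) - c *: 'X^N) * y2
   + c *: 'X^N * y2 + geo (nu y) * b%:P * ('X^t * (E - bar E)).
  by rewrite /conj_odd; move: (geo (nu y2)) => g2; rewrite /y2 -!mul_polyC; ring.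
rewrite !dvdp_add //.
- rewrite dvdp_mulr //; apply: dvdp_trans geo_translate.
  by rewrite dvdp_exp2l //; lia.
- rewrite dvdp_mulr // -mul_polyC dvdp_mull // dvdp_exp2l //; lia.
rewrite dvdp_mull //; apply: (@dvdp_trans _ ('X^t * 'X^k)); last by rewrite dvdp_mul.
by rewrite -exprD dvdp_exp2l //; lia.
Qed.

End Translate.
Hypotheses (sE : forall x, s x = x ^+ q) (cardF : #|F| = (q ^ 2)%N).

Local Notation gU := (gU h sE cardF).

Lemma bar_nu y : bar (nu y) = nu y.
Proof. by rewrite /nu !rmorphM /= map_polyX (barK sE cardF) [y * _]mulrC. Qed.

Lemma bar_geo z : bar z = z -> bar (geo z) = geo z.
Proof.
move=> zb; rewrite /geo rmorph_sum; apply: eq_bigr => i _.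
by rewrite rmorphXn /= zb.
Qed.

Lemma conj_gU E y : E`_0 = 1 -> (gU E 0 ^ gU 1 y)%g = gU (conj_even E y) (conj_odd E y).
Proof.
(* Multiplying on the left by 1 + y tau avoids its inverse: the odd parts then agree, and the even
   parts differ by d (nu y)^h, which is zero modulo X^h. *)
move=> E0; rewrite /conjg; apply: (mulgI (gU 1 y)); rewrite mulKVg.
rewrite !gU_mul ?coef1 ?conj_even0 // !mulr1 !mul0r !addr0 !mul1r.
have bE : bar (conj_even E y) = E - geo (nu y) * (E - bar E).
  rewrite /conj_even rmorphD rmorphM rmorphB /= bar_geo ?bar_nu // (barK sE cardF); ring.
have bO : bar (conj_odd E y) = - (geo (nu y) * bar y * (E - bar E)).
  rewrite /conj_odd !rmorphM rmorphB /= bar_geo ?bar_nu // (barK sE cardF); ring.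
have -> : conj_odd E y + y * bar (conj_even E y) = E * y by rewrite bE /conj_odd; ring.
apply: gU_eq; rewrite ?subrr ?dvdp0 //.
  by rewrite coefD coefMX conj_even0 // addr0.
have -> : E - (conj_even E y + y * bar (conj_odd E y) * 'X) =
   (E - bar E) * (1 + nu y * geo (nu y) - geo (nu y)) by rewrite bO /conj_even /nu; ring.
rewrite {2}geoE opprB addrCA subrr addr0.
by rewrite dvdp_mull // geo_dvd // nuX.
Qed.

End Conj.

(** * Values of the inducing character *)

Section Characters.
Variables (F : finFieldType) (q h : nat) (s : {rmorphism F -> F}).
Hypotheses (sE : forall x, s x = x ^+ q) (cardF : #|F| = (q ^ 2)%N).
Hypothesis h2 : (2 <= h)%N.
Variables (chi : 'CF(HH F q h)) (rho : 'CF(H' F q h)).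
Hypothesis chi_lin : chi \is a linear_char.

Local Notation bar := (map_poly s).
Local Notation N := (h - 1)%N.
Local Notation gU := (gU h sE cardF).
Implicit Types (E O y d p z : {poly F}).

Definition psi (a : F) : algC := chi (gU (1 + a *: 'X^N) 0).

Lemma gU_HH E : E`_0 = 1 -> gU E 0 \in HH F q h.
Proof. by move=> E0; rewrite in_HH ?dvdp0. Qed.

Lemma gU_mul0 E E' O' : E`_0 = 1 -> E'`_0 = 1 -> (gU E 0 * gU E' O')%g = gU (E * E') (E * O').
Proof. by move=> E0 E0'; rewrite gU_mul // !mul0r !addr0. Qed.

Lemma gU_top E E' a : E`_0 = 1 -> E'`_0 = 1 -> 'X^h %| E' - (E + a *: 'X^N) ->
  gU E' 0 = (gU (1 + a *: 'X^N) 0 * gU E 0)%g.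
Proof.
move=> E0 E0' e; have t0 := top_coef0 h2 a.
rewrite gU_mul0 // mulr0; apply: gU_eq; rewrite ?coef0M ?t0 ?E0 ?mulr1 ?subrr ?dvdp0 //.
have -> : E' - (1 + a *: 'X^N) * E = E' - (E + a *: 'X^N) - (a *: 'X^N) * (E - 1) by ring.
rewrite dvdp_sub // {1}(h_predK h2) exprSr -mul_polyC -mulrA dvdp_mull // dvdp_mul //.
by apply: dvdX_coef0; rewrite coefB coef1 E0 subrr.
Qed.

Lemma chi_top E E' a : E`_0 = 1 -> E'`_0 = 1 -> 'X^h %| E' - (E + a *: 'X^N) ->
  chi (gU E' 0) = psi a * chi (gU E 0).
Proof.
by move=> E0 E0' e; rewrite (gU_top E0 E0' e) lin_charM // gU_HH // top_coef0.
Qed.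

Lemma psiD : {morph psi : a b / a + b >-> a * b}.
Proof.
move=> a b; rewrite mulrC; apply: chi_top; rewrite ?top_coef0 //.
have -> : 1 + (a + b) *: 'X^N - (1 + a *: 'X^N + b *: 'X^N) = 0 :> {poly F}.
  by rewrite -!mul_polyC polyCD; ring.
exact: dvdp0.
Qed.

Lemma psi0 : psi 0 = 1.
Proof. by rewrite /psi scale0r addr0 gU1 lin_char1. Qed.

Lemma psi_conductor :
  (exists k1, exists k2, [/\ k1 \in Htop F q h, k2 \in Htop F q h,
      gcoef k2 (Un h) = gcoef k1 (Un h) ^+ q & chi k2 != chi k1]) ->
  exists a, psi (a - s a) != 1.
Proof.
move=> [k1 [k2 [/(HtopP h2 sE cardF) e1 /(HtopP h2 sE cardF) e2 g12]]].
rewrite e1 e2 g12 -sE; set a := gcoef k1 _ => ne; exists a.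
apply: contraNneq ne => a1; rewrite -/(psi _) -[chi (gU (1 + a *: _) 0)]/(psi _).
by rewrite eq_sym -{1}(subrK (s a) a) psiD a1 mul1r.
Qed.

(* For h odd and h even alike, this is all that is used about the inducing character:
   it sees E modulo X^h and O only modulo X^(h./2). *)
Definition rho_spec := (forall E, E`_0 = 1 -> rho (gU E 0) = chi (gU E 0)) /\
  forall E O E' O' a, E`_0 = 1 -> E'`_0 = 1 -> inH' h s O ->
    'X^h %| E' - (E + a *: 'X^N) -> 'X^(h./2) %| O' - O ->
    rho (gU E' O') = psi a * rho (gU E O).

Lemma rho_spec_odd : odd h ->
  (forall g k, g \in H' F q h -> k \in HH F q h ->
     (forall i, (1 <= i <= h - 1)%N -> gcoef g (2 * i) = gcoef k (2 * i)) ->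
     rho g = chi k) -> rho_spec.
Proof.
move=> ho H.
have rE E O : E`_0 = 1 -> inH' h s O -> rho (gU E O) = chi (gU E 0).
  move=> E0 O1; apply: H => [||i iN]; rewrite ?in_H' ?gU_HH //.
  by rewrite !gcoef_gU //= /Un ?mul2n ?odd_double //; lia.
split=> [E E0|E O E' O' a E0 E0' O1 eE eO].
  by apply: rE => //; rewrite inH'_dvd // dvdp0.
have O1' : inH' h s O' by rewrite (inH'_mod s h2 eO).
by rewrite (rE E O) // (rE E' O') //; apply: chi_top.
Qed.

(** The values are given on products of H and H_1' only, so E + O tau is factored as E (1 + V O
    tau), V being inverse to E modulo X^h. A change of O is absorbed by a factor 1 + w tau on which
    [theta] is 1. *)
Lemma rho_spec_even : ~~ odd h ->
  (exists theta : 'CF(H1' F q h),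
       [/\ theta \is a linear_char,
           (forall g k, g \in H0' F q h -> k \in Htop F q h ->
              gcoef g (Un h) = gcoef k (Un h) -> theta g = chi k) &
           (forall k m, k \in HH F q h -> m \in H1' F q h ->
              rho (k * m)%g = chi k * theta m)]) -> rho_spec.
Proof.
move=> ho [theta [th_lin th0 H]].
have c1 : (1 : {poly F})`_0 = 1 by rewrite coef1.
split=> [E E0|E O E' O' a E0 E0' O1 eE eO].
  by rewrite -[gU E 0]mulg1 H ?group1 ?gU_HH // lin_char1 // mulr1 mulg1.
have [V V0 EV] := inv_modXh h2 E0.
have hN : ('X^N : {poly F}) %| 'X^h by rewrite dvdp_exp2l //; lia.
(* The same V serves every E1 congruent to E modulo X^N, because odd parts matter only modulo
   X^N. *)
have dec E1 O2 : E1`_0 = 1 -> 'X^N %| E1 - E -> gU E1 O2 = (gU E1 0 * gU 1 (V * O2))%g.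
  move=> E10 dE; rewrite gU_mul0 // mulr1; apply: gU_eq; rewrite ?subrr ?dvdp0 //.
  have -> : O2 - E1 * (V * O2) = - (E * V - 1) * O2 - (E1 - E) * (V * O2) by ring.
  by rewrite dvdp_sub // dvdp_mulr // dvdpNr (dvdp_trans hN).
have VO1 : inH' h s (V * O).
  have := inH'_closed V0 c1 (O := 0) (O' := O) _ O1.
  by rewrite mul0r addr0; apply; rewrite inH'_dvd // dvdp0.
pose w := V * (O' - O).
have dw : 'X^(h./2) %| w by rewrite dvdp_mull.
(* The product has an even cross term of order at least N./2 + h./2 + 1, which is h for even h. *)
have VO' : gU 1 (V * O') = (gU 1 (V * O) * gU 1 w)%g.
  rewrite gU_mul // !mul1r rmorph1 mulr1; apply: gU_eq; rewrite ?gU_coef0 //.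
  - by rewrite -[1 as X in X + _]mulr1 gU_coef0.
  - rewrite opprD addNKr dvdpNr.
    apply: (@dvdp_trans _ ('X^(N./2) * 'X^(h./2) * 'X)).
      by rewrite -exprD -exprSr dvdp_exp2l //; lia.
    by rewrite !dvdp_mul ?dvdp_bar //; case/andP: VO1.
  by rewrite (_ : _ - _ = 0) ?dvdp0 // /w; ring.
(* Comparison with the identity of the top subgroup: both top coefficients are 0. *)
have thw : theta (gU 1 w) = 1.
  rewrite (th0 _ 1%g) ?in_H0' ?group1 ?lin_char1 //.
  by rewrite gcoef_top // -(gU1 h sE cardF) gcoef_top // coef1.
have w1 : gU 1 w \in H1' F q h by rewrite in_H1' // inH'_dvd.
have vo1 : gU 1 (V * O) \in H1' F q h by rewrite in_H1'.
rewrite (dec E O) ?subrr ?dvdp0 // (dec E' O') //; last first.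
  have -> : E' - E = E' - (E + a *: 'X^N) + a *: 'X^N by ring.
  by rewrite (dvdp_add (dvdp_trans hN eE)) // -mul_polyC dvdp_mull.
rewrite !H ?gU_HH ?VO' ?groupM // lin_charM // thw mulr1.
by rewrite (chi_top E0 E0' eE) mulrA.
Qed.

Hypothesis rhoP : rho_spec.

Variable E : {poly F}.
Hypothesis E0 : E`_0 = 1.
Let f y := rho (gU E 0 ^ gU 1 y)%g.

Lemma rho_conj_small y j k : 'X^j %| y -> 'X^k %| E - bar E ->
    (N <= j + j + 1 + k)%N -> (0 < k)%N ->
  f y = chi (gU E 0) * psi (nu s y * (E - bar E))`_N.
Proof.
move=> jy kd jk k0; case: rhoP => rho0 rhoR; rewrite /f conj_gU // mulrC -rho0 //.
apply: rhoR => //; first exact: conj_even0.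
- by rewrite inH'_dvd // dvdp0.
- exact: conj_even_small jy kd jk k0.
by rewrite subr0; exact: conj_odd_small jy kd jk k0.
Qed.

Lemma rho_conj_translate y b j k t : 'X^j %| y -> 'X^k %| E - bar E ->
  (j + k + 1 + t)%N = N -> (j < t)%N -> (0 < k)%N ->
  f (y + b *: 'X^t) = f y * psi ((E - bar E)`_k * (b * s y`_j + s b * y`_j)).
Proof.
move=> jy kd jkt jt k0; case: rhoP => rho0 rhoR; rewrite /f !conj_gU // mulrC.
have dE := conj_even_translate h2 b jy kd jkt jt.
have dO := conj_odd_translate h2 b jy kd jkt jt.
(* Membership in H' sees the odd part modulo X^(h./2) only, so if one conjugate is outside H', so is
   the other, and both values are 0. *)
case: (boolP (inH' h s (conj_odd h s E y))) => O1; first by apply: rhoR; rewrite ?conj_even0.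
by rewrite !cfun0 ?mulr0 // in_H' ?conj_even0 // (inH'_mod s h2 dO).
Qed.

End Characters.

(** * Sums over U *)

Section PolySums.
Variables (F : finFieldType) (N : nat).
Implicit Types (c e : {ffun 'I_N -> F}) (p : {poly F}).

(** Representatives of F[X] / X^N, indexed by a finite type so that they can be summed over. *)
Definition fpoly c : {poly F} := \sum_(i < N) c i *: 'X^i.

Lemma coef_fpoly c (i : 'I_N) : (fpoly c)`_i = c i.
Proof.
rewrite coef_sum (bigD1 i) //= coefZ coefXn eqxx mulr1 big1 ?addr0 // => j ji.
by rewrite coefZ coefXn val_eqE eq_sym (negPf ji) mulr0.
Qed.

Lemma fpolyP p : exists c, 'X^N %| p - fpoly c.
Proof.
exists [ffun i : 'I_N => p`_i]; apply/dvdp_XnP => i iN.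
by rewrite coefB (coef_fpoly _ (Ordinal iN)) ffunE subrr.
Qed.

Lemma fpoly_inj c e : 'X^N %| fpoly c - fpoly e -> c = e.
Proof.
move=> ce; apply/ffunP => i; rewrite -!coef_fpoly.
exact: (polyXn_sub_coef ce).
Qed.

Lemma fpolyD_delta c (b : F) (t : 'I_N) :
  fpoly (c + [ffun i => b *+ (i == t)]) = fpoly c + b *: 'X^t.
Proof.
rewrite [in RHS]/fpoly /fpoly.
under eq_bigr => i _ do rewrite !ffunE scalerDl.
rewrite big_split /=; congr (_ + _).
rewrite (bigD1 t) //= eqxx mulr1n big1 ?addr0 // => i /negPf ->.
by rewrite mulr0n scale0r.
Qed.

Definition low_zero (j : nat) c := [forall i : 'I_N, (i < j)%N ==> (c i == 0)].

Lemma low_zeroE j c : (j <= N)%N -> low_zero j c = ('X^j %| fpoly c).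
Proof.
move=> jN; apply/forallP/dvdp_XnP => [H i ij|H i].
  have iN := leq_trans ij jN.
  by have := H (Ordinal iN); rewrite /= ij -coef_fpoly => /eqP.
by apply/implyP => ij; rewrite -coef_fpoly H.
Qed.

Lemma prod_step (A B : algC) (j : nat) : (j < N)%N ->
  \prod_(i < N) (if (i < j)%N then 1 else if i == j :> nat then A else B) = A * B ^+ (N - j.+1).
Proof.
move=> jN; rewrite -(big_mkord xpredT (fun i => if (i < j)%N then 1 else if i == j then A else B)).
rewrite (@big_cat_nat _ _ _ j) ?(ltnW jN) //= big_nat big1 ?mul1r => [|i /andP[_ ->] //].
rewrite big_ltn // ltnn eqxx; congr (_ * _).
rewrite big_nat (eq_bigr (fun _ => B)) => [|i /andP[ji _]]; last by rewrite ltnNge ltnW //= gtn_eqF.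
by rewrite -big_nat prodr_const_nat.
Qed.

(** The summand is a product over coordinates, so the sum factors: coordinates below j give 1,
    coordinate j gives the sum of [G], and each later one gives [#|F|]. *)
Lemma sum_low_zero (G : F -> algC) (j : 'I_N) :
  \sum_(c | low_zero j c) G (c j) = (\sum_x G x) * #|F|%:R ^+ (N - j.+1).
Proof.
pose H (i : 'I_N) x := if (i < j)%N then (x == 0)%:R else if i == j then G x else 1.
rewrite -(prod_step _ _ (ltn_ord j)).
transitivity (\prod_i \sum_x H i x); last first.
  apply: eq_bigr => i _; rewrite /H -val_eqE /=; case: ifP => _.
    by rewrite (bigD1 0) //= eqxx big1 ?addr0 // => x /negPf ->.
  by case: ifP => _ //; rewrite sumr_const.
rewrite bigA_distr_bigA big_mkcond /=; apply: eq_bigr => c _.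
case: ifP => [/forallP low|nlow].
  rewrite (bigD1 j) //= /H ltnn eqxx big1 ?mulr1 // => i /negPf ij.
  by rewrite ij; case: ifP => // ilt; have := low i; rewrite ilt => /eqP ->; rewrite eqxx.
have /forallPn[i] := negbT nlow; rewrite negb_imply => /andP[ij ci].
by rewrite (bigD1 i) //= /H ij (negPf ci) mul0r.
Qed.

End PolySums.

(** * Coset representatives, indices and induced characters *)

Section Restriction.
Variables (F : finFieldType) (q h : nat) (s : {rmorphism F -> F}).
Hypotheses (sE : forall x, s x = x ^+ q) (cardF : #|F| = (q ^ 2)%N).
Hypothesis h2 : (2 <= h)%N.

Local Notation bar := (map_poly s).
Local Notation N := (h - 1)%N.
Local Notation gU := (gU h sE cardF).
Implicit Types (E O y p : {poly F}) (c e : {ffun 'I_N -> F}).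

Let c1 : (1 : {poly F})`_0 = 1. Proof. by rewrite coef1. Qed.

(** As E is invertible modulo X^h, each element is uniquely E (1 + e tau) with e modulo X^N: the 1 +
    e tau represent the cosets of H. *)
Lemma sum_cosets (K : {group gT F h}) (G : gT F h -> algC) :
    HH F q h \subset K -> K \subset UU F q h ->
  \sum_(x in K) G x =
  \sum_(g in HH F q h) \sum_(e : {ffun 'I_N -> F} | gU 1 (fpoly e) \in K) G (g * gU 1 (fpoly e))%g.
Proof.
move=> HK KU; rewrite pair_big_dep /=.
pose A := [set u : gT F h * {ffun 'I_N -> F} | (u.1 \in HH F q h) && (gU 1 (fpoly u.2) \in K)].
pose m (u : gT F h * {ffun 'I_N -> F}) := (u.1 * gU 1 (fpoly u.2))%g.
have eK : K = [set m u | u in A] :> {set _}.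
  apply/setP => x; apply/idP/imsetP => [xK|[[g e]]]; last first.
    by rewrite inE => /andP[/= gH eK] ->; rewrite groupM // (subsetP HK).
  have [E [O [E0 ex]]] := UUP h2 sE cardF (subsetP KU _ xK).
  have [V V0 EV] := inv_modXh h2 E0; have [e de] := fpolyP N (V * O).
  have xm : x = m (gU E 0, e).
    rewrite ex /m gU_mul0 // mulr1; apply: gU_eq; rewrite ?subrr ?dvdp0 //=.
    have -> : O - E * fpoly e = E * (V * O - fpoly e) - (E * V - 1) * O by ring.
    rewrite (dvdp_sub (dvdp_mull _ de)) // dvdp_mulr // (dvdp_trans _ EV) //.
    by rewrite dvdp_exp2l //; lia.
  exists (gU E 0, e) => //; rewrite inE /= gU_HH //=.
  by rewrite -(groupMl _ (subsetP HK _ (gU_HH sE cardF h2 E0))) -/(m (gU E 0, e)) -xm.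
rewrite [in LHS]eK big_imset => [|[g e] [g' e']].
  by apply: eq_bigl => u; rewrite inE.
rewrite !inE /= => /andP[/(HHP h2 sE cardF)[E E0 ->] _] /andP[/(HHP h2 sE cardF)[E' E0' ->] _].
rewrite /m /= => em; have := em; rewrite !gU_mul0 // !mulr1.
move=> /(gU_eqP sE cardF h2 _ _ E0 E0')/andP[dE dO].
have eE : gU E 0 = gU E' 0 by apply: gU_eq; rewrite ?subrr ?dvdp0.
move: em; rewrite eE => /mulgI /(gU_eqP sE cardF h2 _ _ c1 c1)/andP[_ de].
by rewrite (fpoly_inj de).
Qed.

Lemma HH_sub_UU : HH F q h \subset UU F q h.
Proof. by apply/subsetP => g /(HHP h2 sE cardF)[E E0 ->]; apply: in_UU. Qed.

Lemma H'_sub_UU : H' F q h \subset UU F q h.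
Proof. by apply/subsetP => g /(H'P h2 sE cardF)[E [O [E0 _ ->]]]; apply: in_UU. Qed.

Lemma HH_sub_H' : HH F q h \subset H' F q h.
Proof.
apply/subsetP => g /(HHP h2 sE cardF)[E E0 ->].
by rewrite in_H' // inH'_dvd // dvdp0.
Qed.

Lemma HH_conj g x : g \in HH F q h -> x \in HH F q h -> (g ^ x)%g = g.
Proof.
move=> /(HHP h2 sE cardF)[E E0 ->] /(HHP h2 sE cardF)[E' E0' ->].
by apply/conjg_fixP/commgP; rewrite /commute !gU_mul0 // mulrC !mulr0.
Qed.

Lemma sum_fixed : \sum_x (if s x == x then 1 else 0) = q%:R :> algC.
Proof.
rewrite -big_mkcond /= sumr_const; congr (_%:R).
by rewrite -[RHS](card_fixed sE cardF) cardsE.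
Qed.

(** The number of admissible e is (q^2)^(N - N./2) for odd h and q (q^2)^(N - N./2 - 1) for even h;
    both are q^N. *)
Lemma card_H' : #|H' F q h|%:R = #|HH F q h|%:R * q%:R ^+ N :> algC.
Proof.
rewrite -sumr_const (sum_cosets _ HH_sub_H' H'_sub_UU) sumr_const mulr_natl.
congr (_ *+ _); have N2 : (N./2 < N)%N by lia.
pose G (x : F) : algC := if odd h || (s x == x) then 1 else 0.
transitivity (\sum_(e | low_zero N./2 e) G (e (Ordinal N2))).
  rewrite -big_mkcondr /=; apply: eq_bigl => e.
  by rewrite in_H' // /inH' low_zeroE 1?ltnW // (coef_fpoly e (Ordinal N2)).
rewrite (sum_low_zero G (Ordinal N2)) cardF natrX -exprM /G /=.
case: (boolP (odd h)) => /= ho.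
  by rewrite sumr_const cardF natrX -exprD; congr (_ ^+ _); lia.
rewrite sum_fixed.
by rewrite -exprS; congr (_ ^+ _); lia.
Qed.

Lemma GG_sub_HH k : (k < N)%N -> GG F q h k \subset HH F q h.
Proof.
move=> kN; have kh : (k < h)%N by lia.
apply/subsetP => x /(UsubP sE cardF h2 _ (PG_closed h2 sE cardF kh))[E [O [E0]]].
by rewrite (PG_coefs_of h2 sE cardF) // => /andP[dO _] ->; rewrite in_HH.
Qed.

(** Writing E = 1 + X c, membership in G_k confines k of the N free coefficients to F_q, each at the
    cost of a factor q. *)
Lemma index_GG k : (k < N)%N ->
  #|HH F q h|%:R = #|GG F q h k|%:R * q%:R ^+ k :> algC.
Proof.
move=> kN; pose g c := gU (1 + 'X * fpoly c) 0.
have g0 c : (1 + 'X * fpoly c)`_0 = 1 by rewrite coefD c1 coefXM addr0.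
have g_inj : injective g.
  move=> c c' /(gU_eqP sE cardF h2 _ _ (g0 _) (g0 _))/andP[dE _].
  apply: fpoly_inj; move: dE; rewrite opprD addrACA subrr add0r -mulrBr.
  by rewrite {1}(h_predK h2) exprS dvdp_mul2l ?polyX_eq0.
pose A := [set c : {ffun 'I_N -> F} | [forall i : 'I_N, (i < k)%N ==> (s (c i) == c i)]].
have imH : HH F q h = g @: setT :> {set _}.
  apply/setP => x; apply/idP/imsetP => [/(HHP h2 sE cardF)[E E0 ->]|[c _ ->]]; last exact: gU_HH.
  have XE : 'X %| E - 1 by apply: dvdX_coef0; rewrite coefB coef1 E0 subrr.
  have [p ep] := dvdpP _ _ XE; have [c dc] := fpolyP N p; exists c => //.
  apply: gU_eq; rewrite ?g0 ?subrr ?dvdp0 //.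
  have -> : E - (1 + 'X * fpoly c) = 'X * (p - fpoly c) by rewrite -[E](subrK 1) ep; ring.
  by rewrite {1}(h_predK h2) exprS dvdp_mul2l ?polyX_eq0.
have imG : GG F q h k = g @: A :> {set _}.
  have inA c : (g c \in GG F q h k) = (c \in A).
    rewrite in_GG ?dvdp0 //=; last by lia.
    rewrite inE; apply/dvdp_XnP/forallP => [H i|H [|i] ik].
    - apply/implyP => ik; have := H i.+1 ik.
      rewrite coefB coef_map coefD coef1 coefXM /= add0r coef_fpoly.
      by move/eqP; rewrite subr_eq0 eq_sym.
    - by rewrite coefB coef_map /= g0 rmorph1 subrr.
    have iN : (i < N)%N by lia.
    rewrite coefB coef_map coefD coef1 coefXM /= add0r (coef_fpoly c (Ordinal iN)).
    by have := H (Ordinal iN); rewrite -ltnS ik /= => /eqP ->; rewrite subrr.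
  apply/setP => x; apply/idP/imsetP => [xG|[c cA ->]]; last by rewrite inA.
  have := subsetP (GG_sub_HH kN) _ xG.
  rewrite imH => /imsetP[c _ ex]; exists c => //; by rewrite -inA -ex.
rewrite imH imG !card_imset // cardsT card_ffun card_ord cardF.
have -> : #|A|%:R = q%:R ^+ k * (q%:R ^+ 2) ^+ (N - k) :> algC.
  pose H (i : 'I_N) x : algC := if (i < k)%N then (if s x == x then 1 else 0) else 1.
  transitivity (\prod_(i < N) (if (i < k)%N then q%:R else q%:R ^+ 2 : algC)); last first.
    rewrite -(big_mkord xpredT (fun i => if (i < k)%N then q%:R else q%:R ^+ 2 : algC)).
    rewrite (@big_cat_nat _ _ _ k) ?(ltnW kN) //=; congr (_ * _).
      rewrite big_nat (eq_bigr (fun _ => q%:R)) => [|i /andP[_ ->] //].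
      by rewrite -big_nat prodr_const_nat subn0.
    rewrite big_nat (eq_bigr (fun _ => q%:R ^+ 2)) => [|i /andP[ki _]]; last by rewrite ltnNge ki.
    by rewrite -big_nat prodr_const_nat.
  transitivity (\prod_i \sum_x H i x); last first.
    apply: eq_bigr => i _; rewrite /H; case: ifP => _; last by rewrite sumr_const cardF natrX.
    exact: sum_fixed.
  rewrite bigA_distr_bigA -sumr_const big_mkcond /=; apply: eq_bigr => c _.
  rewrite inE; case: ifP => [/forallP low|/negbT/forallPn[i]].
    rewrite big1 // => i _; rewrite /H; case: ifP => // ik.
    by have := low i; rewrite ik /= => ->.
  by rewrite negb_imply => /andP[ik ci]; rewrite (bigD1 i) //= /H ik (negPf ci) mul0r.
rewrite -natrX -!exprM -!natrX -!natrM -!expnM -!expnD; congr (_%:R); congr (_ ^ _)%N; lia.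
Qed.

(** H is abelian, so conjugation changes nothing and only the index q^k remains. *)
Lemma cfInd_GG (chi : 'CF(HH F q h)) k g : (k < N)%N -> g \in HH F q h ->
  'Ind[HH F q h] ('Res[GG F q h k] chi) g = if g \in GG F q h k then q%:R ^+ k * chi g else 0.
Proof.
move=> kN gH.
have GH := GG_sub_HH kN.
rewrite cfIndE // (eq_bigr (fun _ => 'Res[GG F q h k] chi g)) => [|x xH]; last by rewrite HH_conj.
rewrite sumr_const; case: ifP => gG; last by rewrite cfun0 ?gG // mul0rn mulr0.
rewrite cfResE // -[chi g *+ _]mulr_natl (index_GG kN) !mulrA mulVf ?mul1r //.
by rewrite pnatr_eq0 -lt0n cardG_gt0.
Qed.

Lemma cfInd_H' (rho : 'CF(H' F q h)) g : g \in HH F q h ->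
  'Ind[UU F q h] rho g = (q%:R ^+ N)^-1 * \sum_(e : {ffun 'I_N -> F}) rho (g ^ gU 1 (fpoly e))%g.
Proof.
move=> gH; rewrite cfIndE ?H'_sub_UU // (sum_cosets _ HH_sub_UU (subxx _)).
rewrite (eq_bigr (fun _ => \sum_(e : {ffun 'I_N -> F}) rho (g ^ gU 1 (fpoly e))%g))
  => [|x xH]; last first.
  apply: eq_big => [e|e _]; first by rewrite in_UU.
  by rewrite conjgM (HH_conj gH xH).
rewrite sumr_const card_H' -[X in _ * X]mulr_natl mulrA; congr (_ * _).
by rewrite invfM mulrAC mulVf ?mul1r // pnatr_eq0 -lt0n cardG_gt0.
Qed.

(** * Evaluation of the sum over conjugates *)

Section CharacterSum.
Variables (chi : 'CF(HH F q h)) (rho : 'CF(H' F q h)).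
Hypotheses (chi_lin : chi \is a linear_char) (rhoP : rho_spec sE cardF chi rho).
Local Notation psi := (psi sE cardF chi).
Hypothesis psi_cond : exists a, psi (a - s a) != 1.
Variables (E : {poly F}) (k : nat).
Hypotheses (E0 : E`_0 = 1) (k0 : (0 < k <= N)%N) (kd : 'X^k %| E - bar E).
Hypothesis dk0 : (k < N)%N -> (E - bar E)`_k != 0.
Let f y := rho (gU E 0 ^ gU 1 y)%g.

Lemma twist_coef_val : s (E - bar E)`_k = - (E - bar E)`_k.
Proof. by rewrite coefB coef_map rmorphB /= (twistK sE cardF) opprB. Qed.

Lemma sum_low_zero_step j : (j < (N - k)./2)%N ->
  \sum_(e : {ffun 'I_N -> F} | low_zero j e) f (fpoly e) =
  \sum_(e : {ffun 'I_N -> F} | low_zero j.+1 e) f (fpoly e).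
Proof.
move=> jk; have jN : (j < N)%N by lia.
have tN : (N - 1 - k - j < N)%N by lia.
pose jo := Ordinal jN; pose t := Ordinal tN.
have jt : (j < t)%N by rewrite /=; lia.
have jkt : (j + k + 1 + t)%N = N by rewrite /=; lia.
pose P e := low_zero j e && (e jo != 0).
have lowS e : low_zero j.+1 e = low_zero j e && (e jo == 0).
  apply/forallP/andP => [H|[/forallP H ej] i].
    split; last by have := H jo; rewrite /= ltnSn.
    by apply/forallP => i; apply/implyP => ij; have := H i; rewrite ltnS ltnW.
  apply/implyP; rewrite ltnS leq_eqVlt => /orP[/eqP ij|ij]; last by have := H i; rewrite ij.
  by rewrite (_ : i = jo) //; apply: val_inj.
rewrite (bigID (fun e => e jo == 0)) /= -[RHS]addr0; congr (_ + _).
  by apply: eq_bigl => e; rewrite lowS.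
rewrite -[LHS]/(\sum_(e | P e) _); set S := \sum_(e | P e) _.
(* Translation at an index t > j permutes the e of valuation j, so S is unchanged while each summand
   acquires a value of [psi]. *)
have shift b : S = \sum_(e | P e) f (fpoly e) * psi ((E - bar E)`_k * (b * s (e jo) + s b * e jo)).
  rewrite /S (reindex_inj (addIr [ffun i => b *+ (i == t)])) /=.
  have tj (i : 'I_N) : (i <= j)%N -> (i == t) = false.
    by move=> ij; apply/negbTE; rewrite neq_ltn (leq_ltn_trans ij jt).
  apply: eq_big => [e|e].
    rewrite /P !ffunE tj // mulr0n addr0; congr (_ && _); apply: eq_forallb => i.
    by case: (ltnP i j) => //= ij; rewrite !ffunE tj ?mulr0n ?addr0 // ltnW.
  rewrite /P !ffunE tj // mulr0n addr0 => /andP[le _].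
  rewrite fpolyD_delta /f (rho_conj_translate h2 rhoP E0 b (j := j) (k := k)) //;
    last by case/andP: k0.
    by rewrite (coef_fpoly e jo).
  rewrite -low_zeroE 1?ltnW //; move: le; congr is_true; apply: eq_forallb => i.
  by case: (ltnP i j) => //= ij; rewrite !ffunE tj ?mulr0n ?addr0 // ltnW.
(* Sum over all b. As [s] negates d_k, the argument of [psi] is x - x^q for x = d_k (s e_j) b, and x
   runs over all of F. *)
have : #|F|%:R * S = 0.
  rewrite mulr_natl -sumr_const (eq_bigr _ (fun b _ => shift b)).
  rewrite exchange_big big1 //= => e /andP[_ ej].
  rewrite -mulr_sumr.
  have c0 : (E - bar E)`_k * s (e jo) != 0 by rewrite mulf_neq0 ?fmorph_eq0 // dk0 //; lia.
  rewrite -[RHS](mulr0 (f (fpoly e))); congr (_ * _).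
  rewrite -[RHS](sum_psi_trace (psiD sE cardF h2 chi_lin) psi_cond c0).
  apply: eq_bigr => b _; congr (psi _).
  by rewrite !rmorphM /= twist_coef_val (twistK sE cardF); ring.
move/eqP; rewrite mulf_eq0 pnatr_eq0 => /orP[/eqP F0|/eqP //].
by have := finNzRing_gt1 F; rewrite F0.
Qed.

Lemma sum_conj : \sum_(e : {ffun 'I_N -> F}) f (fpoly e) =
  (-1) ^+ (N - k) * q%:R ^+ (N + k) * chi (gU E 0).
Proof.
have [kpos kN] := andP k0.
have : \sum_(e : {ffun 'I_N -> F}) f (fpoly e) =
    \sum_(e : {ffun 'I_N -> F} | low_zero (N - k)./2 e) f (fpoly e).
  have : ((N - k)./2 <= (N - k)./2)%N by [].
  elim: {1 3}((N - k)./2) => [_|j IHj jk]; last by rewrite IHj 1?ltnW // sum_low_zero_step.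
  by apply: eq_bigl => e; apply/esym/forallP.
(* Now 2j + 1 + k is N for odd N - k and N + 1 for even N - k: the top coefficient is d_k times the
   norm of e_j in the first case and 0 in the second. *)
move=> ->; set j := (N - k)./2; have jN : (j < N)%N by rewrite /j; lia.
pose jo := Ordinal jN.
pose G (x : F) : algC := if odd (N - k) then psi ((E - bar E)`_k * (x * s x)) else 1.
transitivity (chi (gU E 0) * \sum_(e | low_zero j e) G (e jo)).
  rewrite mulr_sumr; apply: eq_bigr => e; rewrite low_zeroE 1?ltnW // => le.
  rewrite /f (rho_conj_small h2 rhoP E0 le kd) //; last by rewrite /j; lia.
  congr (_ * _); rewrite /G.
  have [y ey] := dvdpP _ _ le; have [d ed] := dvdpP _ _ kd.
  have -> : nu s (fpoly e) * (E - bar E) = (y * bar y * d) * 'X^(j + j + 1 + k).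
    by rewrite ed /nu ey rmorphM /= map_polyXn !exprD expr1; ring.
  rewrite coefMXn; case: ifP => [lt|ge]; first by rewrite psi0 //; case: ifP => //; rewrite /j; lia.
  case: ifP => o; last by rewrite /j; lia.
  have -> : (N - (j + j + 1 + k) = 0)%N by rewrite /j; lia.
  rewrite !coef0M -(coef_fpoly e jo) ed ey !coefMXn !ltnn !subnn coef_map mulrC; by congr (psi _).
rewrite (sum_low_zero G jo) cardF natrX -exprM /G mulrC; congr (_ * _).
(* Coordinate j contributes -q or q^2 respectively; with (q^2)^(N - j - 1) from the later ones, both
   products are q^(N + k) up to sign. *)
case: (boolP (odd (N - k))) => o.
  have d0 : (E - bar E)`_k != 0 by apply: dk0; lia.
  have psiM := psiD sE cardF h2 chi_lin.
  rewrite (sum_psi_norm sE cardF psiM psi_cond (psi0 _ _ chi_lin) d0 twist_coef_val).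
  rewrite -signr_odd mulr_sign o mulNr -exprS; congr (- (_ ^+ _)); rewrite /= /j; lia.
rewrite sumr_const cardF natrX -signr_odd mulr_sign (negPf o) -exprD.
congr (_ ^+ _); rewrite /= /j; lia.
Qed.

End CharacterSum.
End Restriction.

(** * The Frobenius map, a geometric sum, and comparison of both sides *)

Lemma Frobenius_power_rmorphism (F : finFieldType) (p r : nat) : p \in [pchar F] ->
  exists s : {rmorphism F -> F}, forall x, s x = x ^+ (p ^ r).
Proof.
move=> chF; elim: r => [|r [s sE]].
  by exists (idfun : {rmorphism F -> F}) => x; rewrite expn0 expr1.
exists (s \o pFrobenius_aut chF : {rmorphism F -> F}) => x.
by rewrite /= pFrobenius_autE sE -exprM expnS.
Qed.

(** Each term is u_i - u_(i+1) with u_i = (-1)^i x^i, so the sum telescopes; the leading x cancels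
    u_1. *)
Lemma sum_alternating_powers (R : comNzRingType) (x : R) k : (0 < k)%N ->
  x + \sum_(1 <= i < k) (-1) ^+ i * (x + 1) * x ^+ i = - ((-1) ^+ k * x ^+ k).
Proof.
elim: k => // -[|k] IHk _; first by rewrite big_geq // addr0 !expr1 mulN1r opprK.
by rewrite big_nat_recr //= addrA IHk // !exprS; ring.
Qed.

(** The valuation is capped at N so that p = 0 is covered; at the cap the coefficient of X^N may or
    may not vanish. *)
Lemma exists_valuation (F : fieldType) (p : {poly F}) N : p`_0 = 0 -> (0 < N)%N ->
  exists k, [/\ (0 < k <= N)%N, 'X^k %| p & (k < N)%N -> p`_k != 0].
Proof.
move=> p0 N0; have ex : exists k, (k == N) || (p`_k != 0) by exists N; rewrite eqxx.
case: (ex_minnP ex) => k kP kmin; exists k; split.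
- rewrite kmin ?eqxx // andbT lt0n; apply: contraTneq kP => ->.
  by rewrite p0 eqxx orbF eq_sym -lt0n.
- apply/dvdp_XnP => i ik; apply/eqP; apply: contraTT ik => pi.
  by rewrite -leqNgt kmin // pi orbT.
by move=> kN; move: kP; rewrite ltn_eqF.
Qed.
Unset Implicit Arguments.

Theorem theorem3p1 (p r h : nat) (F : finFieldType)
    (chi : 'CF(HH F (p ^ r) h)) (rho_sharp : 'CF(H' F (p ^ r) h)) :
  prime p -> (0 < r)%N -> (2 <= h)%N -> #|F| = ((p ^ r) ^ 2)%N ->
  chi \is a linear_char ->
  (* conductor q^2 of psi : a |-> chi(1 + a tau^(2(h-1))) *)
  (exists k1, exists k2, [/\ k1 \in Htop F (p ^ r) h, k2 \in Htop F (p ^ r) h,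
      gcoef k2 (Un h) = gcoef k1 (Un h) ^+ (p ^ r) & chi k2 != chi k1]) ->
  (* rho_sharp is the character chi^sharp (h odd) or tilde-chi_theta (h even)
     of H' whose induction to U is rho_chi *)
  (if odd h then
     forall g k, g \in H' F (p ^ r) h -> k \in HH F (p ^ r) h ->
       (forall i, (1 <= i <= h - 1)%N -> gcoef g (2 * i) = gcoef k (2 * i)) ->
       rho_sharp g = chi k
   else
     exists theta : 'CF(H1' F (p ^ r) h),
       [/\ theta \is a linear_char,
           (forall g k, g \in H0' F (p ^ r) h -> k \in Htop F (p ^ r) h ->
              gcoef g (Un h) = gcoef k (Un h) -> theta g = chi k) &
           (forall k m, k \in HH F (p ^ r) h -> m \in H1' F (p ^ r) h ->
              rho_sharp (k * m)%g = chi k * theta m)]) ->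
  'Res[HH F (p ^ r) h] ('Ind[UU F (p ^ r) h] rho_sharp) =
    (-1) ^+ h *: ((p ^ r)%:R *: chi +
      \sum_(1 <= i < h - 1) ((-1) ^+ i * (p ^ r + 1)%:R) *:
          'Ind[HH F (p ^ r) h] ('Res[GG F (p ^ r) h i] chi)).
Proof.
move=> p_pr _ h2 cardF chi_lin cond rho_hyp.
have chF := card_finPcharP (etrans cardF (esym (expnM p r 2))) p_pr.
have [s sE] := Frobenius_power_rmorphism r chF.
move: (p ^ r)%N => q in chi rho_sharp s sE cardF chi_lin cond rho_hyp *.
have rhoP : rho_spec sE cardF chi rho_sharp.
  case: (boolP (odd h)) rho_hyp => [ho|/negPf ho] rho_hyp; first exact: rho_spec_odd.
  by apply: rho_spec_even => //; rewrite ho.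
have psi_cond := psi_conductor sE cardF h2 chi_lin cond.
apply: cfun_inP => g gH; have [E E0 eg] := HHP h2 sE cardF gH.
have d0 : (E - map_poly s E)`_0 = 0 by rewrite coefB coef_map /= E0 rmorph1 subrr.
have [|k [kN kd dk0]] := exists_valuation (N := (h - 1)%N) d0; first by lia.
have gG i : (i < h - 1)%N -> (g \in GG F q h i) = (i < k)%N.
  move=> iN; rewrite eg in_GG ?dvdp0 //=; last by lia.
  apply/idP/idP => [di|ik]; last by apply: dvdp_trans kd; rewrite dvdp_exp2l.
  rewrite ltnNge; apply/negP => ki; have /eqP := dk0 (leq_ltn_trans ki iN); apply.
  by move/dvdp_XnP: di; apply.
rewrite (cfResE _ (HH_sub_UU sE cardF h2) gH). rewrite (cfInd_H' sE cardF h2 rho_sharp gH) eg.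
rewrite (sum_conj h2 chi_lin rhoP psi_cond E0 kN kd dk0) -eg !cfunE sum_cfunE.
have -> : \sum_(1 <= i < h - 1)
     (((-1) ^+ i * (q + 1)%:R) *: 'Ind[HH F q h] ('Res[GG F q h i] chi)) g
   = (\sum_(1 <= i < k) (-1) ^+ i * (q%:R + 1) * q%:R ^+ i) * chi g.
  (* For i >= k the element g lies outside G_i and the induced character vanishes there. *)
  rewrite (@big_cat_nat _ _ _ k) //=; try by case/andP: kN.
  rewrite [X in _ + X]big_nat [X in _ + X]big1 ?addr0 => [|i /andP[ki iN]]; last first.
    by rewrite cfunE (cfInd_GG sE cardF h2) // gG // ltnNge ki mulr0.
  rewrite mulr_suml !big_nat; apply: eq_bigr => i /andP[i0 ik].
  have iN : (i < h - 1)%N by case/andP: kN => _; apply: leq_trans.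
  by rewrite cfunE (cfInd_GG sE cardF h2) // gG // ik natrD !mulrA.
have [k0 _] := andP kN.
rewrite -mulrDl (sum_alternating_powers _ k0) !mulrA; congr (_ * _).
have qn0 : q%:R != 0 :> algC by rewrite pnatr_eq0 -lt0n ltnW // (q_gt1 cardF).
rewrite mulrAC exprD mulKf ?expf_neq0 // mulrN -mulNr mulrC mulrA; congr (_ * _).
(* Only signs are left: N - k and h + k + 1 have the same parity, as N = h - 1. *)
rewrite mulNr -exprD -[RHS]mulN1r -exprS -[LHS]signr_odd -[RHS]signr_odd.
congr (_ ^+ nat_of_bool _); lia.
Qed.
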